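(* Let $X_n=(y_n,U_n,h_n,r_n)\in\mathcal F_0$, $n\in\mathbb N$, be a sequence and let $X=(y,U,h,r)\in\mathcal F_0$ be such that $X_n\to X$ in $E$ as $n\to\infty$. Then $(u_n,\rho_n,\mu_n)=M(X_n)$ converges to $(u,\rho,\mu)=M(X)$ in $\mathcal D$ in the sense defined in the context (convergence in $\mathcal D$).
   Context: **Eulerian coordinates.** $L^2_{\rm const}(\mathbb R)$ is the set of $\rho\in L^1_{\rm loc}(\mathbb R)$ of the form $\rho=\bar\rho+k$ with $\bar\rho\in L^2(\mathbb R)$, $k\in\mathbb R$; the pair $(\bar\rho,k)$ is uniquely determined by $\rho$. The set $\mathcal D$ consists of all triples $(u,\rho,\mu)$ such that $u\in H^1(\mathbb R)$, $\rho=\bar\rho+k\in L^2_{\rm const}(\mathbb R)$, and $\mu$ is a positive finite Radon measure on $\mathbb R$ whose absolutely continuous part is $\mu_{\rm ac}=(u_x^2+\bar\rho^2)\,dx$. **Convergence in $\mathcal D$.** A sequence $(u_n,\rho_n,\mu_n)\in\mathcal D$, $\rho_n=\bar\rho_n+k_n$, converges to $(u,\rho,\mu)\in\mathcal D$, $\rho=\bar\rho+k$, if, with $F_n(x)=\mu_n((-\infty,x])$, $F(x)=\mu((-\infty,x])$, $F_n(\infty)=\mu_n(\mathbb R)$, $F(\infty)=\mu(\mathbb R)$, as $n\to\infty$: (i) $u_n\to u$ in $L^2(\mathbb R)\cap L^\infty(\mathbb R)$; (ii) $u_{n,x}\rightharpoonup u_x$ weakly in $L^2(\mathbb R)$; (iii)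 $\bar\rho_n\rightharpoonup\bar\rho$ weakly in $L^2(\mathbb R)$; (iv) $k_n\to k$; (v) $\int_{\mathbb R}\frac{u_{n,x}^2}{1+u_{n,x}^2+\bar\rho_n^2}dx\to\int_{\mathbb R}\frac{u_x^2}{1+u_x^2+\bar\rho^2}dx$; (vi) $\int_{\mathbb R}\frac{\bar\rho_n^2}{1+u_{n,x}^2+\bar\rho_n^2}dx\to\int_{\mathbb R}\frac{\bar\rho^2}{1+u_x^2+\bar\rho^2}dx$; (vii) $F_n(x)\to F(x)$ for every $x$ at which $F$ is continuous; (viii) $F_n(\infty)\to F(\infty)$. **Lagrangian coordinates.** $V=\{f\in C_b(\mathbb R): f_\xi\in L^2(\mathbb R)\}$ with $\|f\|_V=\|f\|_{L^\infty}+\|f_\xi\|_{L^2}$, where $C_b(\mathbb R)=C(\mathbb R)\cap L^\infty(\mathbb R)$. $E=V\times H^1(\mathbb R)\times L^2(\mathbb R)\times L^2(\mathbb R)\times\mathbb R$ with norm $\|(\zeta,U,h,\bar r,k)\|_E=\|\zeta\|_V+\|U\|_{H^1}+\|h\|_{L^2}+\|\bar r\|_{L^2}+|k|$. A tuple $(\zeta,U,h,\bar r,k)\in E$ is identified with $(y,U,h,r)$, where $y=\zeta+\mathrm{Id}$ and $r=\bar r+k y_\xi$; convergence in $E$ refers to $(\zeta,U,h,\bar r,k)$. The set $\mathcal F_0$ consists of all $X=(y,U,h,r)\in E$ such that $\zeta,U\in W^{1,\infty}(\mathbb R)$, $h,r\in L^\infty(\mathbb R)$; $y_\xi\ge0$,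 $h\ge0$, $y_\xi+h>0$ a.e.; $y_\xi h=U_\xi^2+\bar r^2$ a.e.; and $y(\xi)+H(\xi)=\xi$ for all $\xi\in\mathbb R$, where $H(\xi)=\int_{-\infty}^\xi h(\eta)\,d\eta$. **The map $M:\mathcal F_0\to\mathcal D$.** For $X=(y,U,h,r)\in\mathcal F_0$ with $r=\bar r+ky_\xi$, $M(X)=(u,\rho,\mu)$ is defined by $u(x)=U(\xi)$ for any $\xi$ with $x=y(\xi)$; $\mu=y_\#(h\,d\xi)$; $\bar\rho(x)\,dx=y_\#(\bar r\,d\xi)$; $\rho=k+\bar\rho$. Here $y_\#(f\,d\xi)(A)=\int_{y^{-1}(A)}f(\xi)\,d\xi$ for Borel sets $A$. It is known that $M$ is well defined with values in $\mathcal D$ (in particular $y_\#(\bar r\,d\xi)$ is absolutely continuous). *)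

(* Defs.v *)
From HB Require Import structures.
From mathcomp Require Import all_boot all_order all_algebra.
From mathcomp Require Import all_classical all_reals all_analysis.

Set Implicit Arguments.
Unset Strict Implicit.
Unset Printing Implicit Defensive.
Import Order.TTheory GRing.Theory Num.Theory.
Import numFieldNormedType.Exports.

Local Open Scope classical_set_scope.
Local Open Scope ring_scope.

(* Elements of Lebesgue and Sobolev spaces are represented by functions; H^1
   and V consist of continuous functions, and everything else depends on the
   representatives only up to a.e. equality. *)

Notation leb R := (@lebesgue_measure R).
Notation borelR R := (measurableTypeR R).

Section function_spaces.
Context (R : realType).
Implicit Types (f g phi : R -> R).

Definition in_Lp (p : \bar R) f : Prop := f \in Lfun (leb R) p.

Definition norm_Lp (p : \bar R) f : \bar R := 'N[leb R]_p[EFin \o f]%E.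

Definition test_function phi : Prop :=
  [/\ forall x, derivable phi x 1,
      continuous (derive1 phi) &
      compact (closure [set x | phi x != 0])].

(* Weak derivatives are tested against compactly supported C^1 functions, as
   in Brezis' textbook; smooth test functions give the same notion. *)
Definition is_weak_derivative f g : Prop :=
  [/\ locally_integrable setT f,
      locally_integrable setT g &
      forall phi, test_function phi ->
        \int[leb R]_x (f x * derive1 phi x) = - \int[leb R]_x (g x * phi x)].

Definition weakly_differentiable f : Prop :=
  exists g, is_weak_derivative f g.

(* The weak derivative is unique up to a.e. equality; [wderiv f] picks a
   representative (and is 0 if [f] is not weakly differentiable). *)
Definition wderiv f : R -> R := xget (cst 0) [set g | is_weak_derivative f g].

(* An H^1 class has exactly one continuous representative, and is identified
   with it. *)
Definition in_H1 f : Prop :=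
  [/\ continuous f, in_Lp 2%:E f, weakly_differentiable f &
      in_Lp 2%:E (wderiv f)].

Definition norm_H1 f : \bar R :=
  ((norm_Lp 2%:E f `^ 2 + norm_Lp 2%:E (wderiv f) `^ 2) `^ 2^-1)%E.

Definition in_W1oo f : Prop :=
  [/\ in_Lp +oo%E f, weakly_differentiable f & in_Lp +oo%E (wderiv f)].

Definition in_V f : Prop :=
  [/\ continuous f, in_Lp +oo%E f, weakly_differentiable f &
      in_Lp 2%:E (wderiv f)].

Definition norm_V f : \bar R :=
  (norm_Lp +oo f + norm_Lp 2%:E (wderiv f))%E.

Definition weak_cvg_L2 (f_ : nat -> R -> R) f : Prop :=
  forall g, in_Lp 2%:E g ->
    (fun n => \int[leb R]_x (f_ n x * g x)) @ \oo
      --> \int[leb R]_x (f x * g x).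

(* [f dx] is the absolutely continuous part of [mu]: by uniqueness of the
   Lebesgue decomposition, this is the existence of a decomposition of [mu]
   into [f dx] and a measure [nu] carried by a Lebesgue null set [N]. *)
Definition ac_part (mu : {measure set (borelR R) -> \bar R}) f : Prop :=
  exists nu : {measure set (borelR R) -> \bar R},
    (exists N : set R, [/\ measurable N, leb R N = 0%E & nu (~` N) = 0%E]) /\
    forall A : set R, measurable A ->
      mu A = (\int[leb R]_(x in A) (f x)%:E + nu A)%E.

Definition dist_fun (mu : {measure set (borelR R) -> \bar R}) (x : R) : R :=
  fine (mu `]-oo, x]%classic).

End function_spaces.

Section eulerian.
Context (R : realType).

(* The function rho in L^2_const is given by its unique decomposition
   rho = rhobar + k. *)
Record eulerian := Eulerian {
  eu_u : R -> R;
  eu_rhobar : R -> R;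
  eu_k : R;
  eu_mu : {finite_measure set (borelR R) -> \bar R} }.

Definition in_D (Y : eulerian) : Prop :=
  [/\ in_H1 (eu_u Y),
      in_Lp 2%:E (eu_rhobar Y) &
      ac_part (eu_mu Y) (fun x => wderiv (eu_u Y) x ^+ 2 + eu_rhobar Y x ^+ 2)].

Definition energy_ratio (w : R -> R) (Y : eulerian) : R :=
  \int[leb R]_x
    (w x ^+ 2 / (1 + wderiv (eu_u Y) x ^+ 2 + eu_rhobar Y x ^+ 2)).

Definition cvg_D (Y_ : nat -> eulerian) (Y : eulerian) : Prop :=
  ((fun n => norm_Lp 2%:E (eu_u (Y_ n) \- eu_u Y)) @ \oo --> 0%E /\
   (fun n => norm_Lp +oo%E (eu_u (Y_ n) \- eu_u Y)) @ \oo --> 0%E) /\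
  weak_cvg_L2 (fun n => wderiv (eu_u (Y_ n))) (wderiv (eu_u Y)) /\
  weak_cvg_L2 (fun n => eu_rhobar (Y_ n)) (eu_rhobar Y) /\
  (fun n => eu_k (Y_ n)) @ \oo --> eu_k Y /\
  (fun n => energy_ratio (wderiv (eu_u (Y_ n))) (Y_ n)) @ \oo
    --> energy_ratio (wderiv (eu_u Y)) Y /\
  (fun n => energy_ratio (eu_rhobar (Y_ n)) (Y_ n)) @ \oo
    --> energy_ratio (eu_rhobar Y) Y /\
  (forall x : R, {for x, continuous (dist_fun (eu_mu Y))} ->
    (fun n => dist_fun (eu_mu (Y_ n)) x) @ \oo --> dist_fun (eu_mu Y) x) /\
  (fun n => fine (eu_mu (Y_ n) setT)) @ \oo --> fine (eu_mu Y setT).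

End eulerian.

Section lagrangian.
Context (R : realType).

Record lagrangian := Lagrangian {
  la_zeta : R -> R;
  la_U : R -> R;
  la_h : R -> R;
  la_rbar : R -> R;
  la_k : R }.

Definition la_y (X : lagrangian) : R -> R := fun xi => la_zeta X xi + xi.

Definition la_r (X : lagrangian) : R -> R :=
  fun xi => la_rbar X xi + la_k X * wderiv (la_y X) xi.

Definition la_sub (X X' : lagrangian) : lagrangian :=
  Lagrangian (la_zeta X \- la_zeta X') (la_U X \- la_U X')
    (la_h X \- la_h X') (la_rbar X \- la_rbar X') (la_k X - la_k X').

Definition in_E (X : lagrangian) : Prop :=
  [/\ in_V (la_zeta X), in_H1 (la_U X), in_Lp 2%:E (la_h X) &
      in_Lp 2%:E (la_rbar X)].

Definition norm_E (X : lagrangian) : \bar R :=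
  (norm_V (la_zeta X) + norm_H1 (la_U X) + norm_Lp 2%:E (la_h X)
    + norm_Lp 2%:E (la_rbar X) + `|la_k X|%:E)%E.

Definition cvg_E (X_ : nat -> lagrangian) (X : lagrangian) : Prop :=
  (fun n => norm_E (la_sub (X_ n) X)) @ \oo --> 0%E.

(* Kept in the extended reals, so that the identity y + H = Id of [in_F0]
   asserts that H is finite. *)
Definition la_H (X : lagrangian) (xi : R) : \bar R :=
  (\int[leb R]_(eta in `]-oo, xi]) (la_h X eta)%:E)%E.

Definition in_F0 (X : lagrangian) : Prop :=
  let y_xi := wderiv (la_y X) in
  let U_xi := wderiv (la_U X) in
  in_E X /\
  [/\ in_W1oo (la_zeta X), in_W1oo (la_U X),
      in_Lp +oo%E (la_h X) & in_Lp +oo%E (la_r X)] /\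
  [/\ {ae leb R, forall xi, 0 <= y_xi xi},
      {ae leb R, forall xi, 0 <= la_h X xi} &
      {ae leb R, forall xi, 0 < y_xi xi + la_h X xi}] /\
  {ae leb R, forall xi,
    y_xi xi * la_h X xi = U_xi xi ^+ 2 + la_rbar X xi ^+ 2} /\
  (forall xi : R, ((la_y X xi)%:E + la_H X xi)%E = xi%:E).

(* The graph of M : F_0 -> D, for arguments with [in_F0 X] and [in_D Y]. The density [rbar] is in L^2 but need not be
   integrable on R, so the identity rhobar dx = y_#(rbar dxi) between signed
   Radon measures is stated on bounded Borel sets, where both sides are finite
   (the preimage is bounded because y - Id is). Since rho = rhobar + k on both
   sides, rho = k + rhobar amounts to the equality of the constants. *)
Definition is_M (X : lagrangian) (Y : eulerian R) : Prop :=
  [/\ forall xi, eu_u Y (la_y X xi) = la_U X xi,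
      forall A : set R, measurable A ->
        eu_mu Y A = (\int[leb R]_(xi in la_y X @^-1` A) (la_h X xi)%:E)%E,
      forall A : set R, measurable A -> bounded_set A ->
        \int[leb R]_(x in A) eu_rhobar Y x
        = \int[leb R]_(xi in la_y X @^-1` A) la_rbar X xi &
      eu_k Y = la_k X].

End lagrangian.

(* Main.v *)
Require Import Defs.
From HB Require Import structures.
From mathcomp Require Import all_boot all_order all_algebra.
From mathcomp Require Import all_classical all_reals all_analysis.
From mathcomp Require Import measurable_realfun ess_sup_inf simple_functions.
From mathcomp Require Import ring lra.

Set Implicit Arguments.
Unset Strict Implicit.
Unset Printing Implicit Defensive.
Import Order.TTheory GRing.Theory Num.Theory.
Import numFieldNormedType.Exports.

Local Open Scope classical_set_scope.
Local Open Scope ring_scope.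

(** On F_0 the identity y + H = Id forces y_xi = 1 - h with 0 <= h <= 1, so y is
    nondecreasing, 1-Lipschitz and onto, and it pushes (1 - h) dxi forward to
    Lebesgue measure. On a fibre of y one has h = 1 a.e., hence U_xi = rbar = 0
    there, and M becomes the pair of pointwise relations
    U_xi = (u_x o y) (1 - h) and rbar = (rhobar o y) (1 - h) a.e.
    Together with (1 - h) h = U_xi^2 + rbar^2 they turn the integrals in (v) and
    (vi) into the integrals of U_xi^2 and rbar^2, which converge. The functions
    u_{n,x} and rhobar_n are bounded in L^2 by the total energy, and their
    integrals over ]y_n(a), y_n(b)] are those of U_{n,xi} and rbar_n over ]a, b];
    this gives convergence on intervals, hence weak convergence. Finally
    F(x) = s - x for the right end s of the fibre over x, so that a uniform bound
    |zeta_n - zeta| <= e gives F(x - e) - e <= F_n(x) <= F(x + e) + e. *)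

(** * Square-integrable functions *)

(** Everything is tested on half-open intervals: [y] pulls []a, b]] back to an interval of the same
    kind, so integrals pass between the two coordinate systems, and Lebesgue differentiation turns
    them into a.e. identities. In (v) and (vi) the denominator is the point: along [y] it equals 1 /
    (1 - h) where h < 1, so the quotient times the Jacobian 1 - h is the square of U_xi or rbar, and
    these converge strongly. For (i) no single substitution handles u_n - u, as u_n and u are
    transported by different flows. Uniform convergence comes from u_n(y_n) = U_n and the modulus of
    continuity of u. It gives L^2 convergence on a bounded window; the tails of u_n are bounded by
    those of U_n because y_n stays at bounded distance from the identity. The masses (viii) are
    settled before (ii) and (iii), whose energy bound must be uniform in n. Young's inequality with
    a free weight [d] stands in for Cauchy-Schwarz; constants such as e / (8 (C + 1)) are choices of
    this weight, the + 1 allowing C = 0. *)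

Section square_integrable.
Context (R : realType).
Implicit Types (f g : R -> R) (D : set (borelR R)).

Definition sq_integrable f : Prop :=
  measurable_fun setT f /\
  (leb R).-integrable setT (EFin \o (fun x => f x ^+ 2)).

Lemma integrable_le_norm D f g : measurable D -> measurable_fun D f ->
  (forall x, D x -> `|f x| <= g x) ->
  (leb R).-integrable D (EFin \o g) -> (leb R).-integrable D (EFin \o f).
Proof.
move=> mD mf fg ig; apply: le_integrable ig => //.
  exact/measurable_EFinP.
by move=> x Dx /=; rewrite lee_fin (le_trans (fg _ Dx))// ler_norm.
Qed.

Lemma integrable_addr D f g : measurable D ->
  (leb R).-integrable D (EFin \o f) -> (leb R).-integrable D (EFin \o g) ->
  (leb R).-integrable D (EFin \o (fun x => f x + g x)).
Proof.
by move=> mD fi gi; have H := integrableD mD fi gi; exact: H.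
Qed.

Lemma integrable_subr D f g : measurable D ->
  (leb R).-integrable D (EFin \o f) -> (leb R).-integrable D (EFin \o g) ->
  (leb R).-integrable D (EFin \o (fun x => f x - g x)).
Proof.
by move=> mD fi gi; have H := integrableB mD fi gi; exact: H.
Qed.

Lemma integrable_scaler D f (c : R) : measurable D ->
  (leb R).-integrable D (EFin \o f) ->
  (leb R).-integrable D (EFin \o (fun x => c * f x)).
Proof.
by move=> mD fi; have H := integrableZl mD c fi; exact: H.
Qed.

Lemma integrable_sqrP f : measurable_fun setT f ->
  (leb R).-integrable setT (EFin \o (fun x => f x ^+ 2)) <->
  (\int[leb R]_x (f x ^+ 2)%:E < +oo)%E.
Proof.
move=> mf; split=> [/integrableP[_]|H].
  by under eq_integral do rewrite /= ger0_norm ?sqr_ge0//.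
apply/integrableP; split.
  by apply/measurable_EFinP; exact: measurable_funX.
by under eq_integral do rewrite /= ger0_norm ?sqr_ge0//.
Qed.

Lemma norm_Lp2E f :
  norm_Lp 2%:E f = ((\int[leb R]_x (f x ^+ 2)%:E) `^ 2^-1)%E.
Proof.
rewrite /norm_Lp unlock; congr poweR; apply: eq_integral => x _.
by rewrite /= powR_mulrn// -normrX ger0_norm ?sqr_ge0.
Qed.

Lemma norm_Lp2_sqr f :
  (norm_Lp 2%:E f `^ 2 = \int[leb R]_x (f x ^+ 2)%:E)%E.
Proof.
rewrite norm_Lp2E -poweRrM mulVf// poweRe1//.
by apply: integral_ge0 => x _; rewrite lee_fin sqr_ge0.
Qed.

Lemma in_Lp2P f : in_Lp 2%:E f <-> sq_integrable f.
Proof.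
split=> [Lf|[mf fi]].
  split; last exact: Lfun2_integrable_sqr.
  by have := Lf; rewrite /in_Lp inE => /andP[]; rewrite inE.
rewrite /in_Lp inE; apply/andP; split; rewrite inE//=.
rewrite /finite_norm -/(norm_Lp _ _) norm_Lp2E poweR_lty//.
exact/integrable_sqrP.
Qed.

Lemma sq_integrableM f g : sq_integrable f -> sq_integrable g ->
  (leb R).-integrable setT (EFin \o (f \* g)).
Proof.
move=> [mf fi] [mg gi].
apply: (@integrable_le_norm _ _ (fun x => f x ^+ 2 + g x ^+ 2)) => //.
- exact: measurable_funM.
- move=> x _ /=; rewrite ler_norml; apply/andP; split; nra.
- exact: integrable_addr.
Qed.

Lemma sq_integrableZ f (c : R) : sq_integrable f ->
  sq_integrable (fun x => c * f x).
Proof.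
move=> [mf fi]; split; first exact: measurable_funM.
by under eq_fun do rewrite /= exprMn; exact: integrable_scaler.
Qed.

Lemma sq_integrable_le f g : measurable_fun setT f ->
  (forall x, `|f x| <= `|g x|) -> sq_integrable g -> sq_integrable f.
Proof.
move=> mf fg [mg gi]; split => //.
apply: integrable_le_norm gi => //; first exact: measurable_funX.
move=> x _; rewrite normrX -[leRHS](real_normK (num_real (g x))).
by rewrite lerXn2r ?nnegrE.
Qed.

Lemma sq_integrableD f g : sq_integrable f -> sq_integrable g ->
  sq_integrable (fun x => f x + g x).
Proof.
move=> [mf fi] [mg gi]; split; first exact: measurable_funD.
apply: (@integrable_le_norm _ _ (fun x => 2 * f x ^+ 2 + 2 * g x ^+ 2)) => //.
- by apply: measurable_funX; exact: measurable_funD.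
- move=> x _ /=; rewrite ger0_norm ?sqr_ge0//.
  by move: (f x) (g x) => a b; have := sqr_ge0 (a - b); nra.
- by apply: integrable_addr => //; exact: integrable_scaler.
Qed.

Lemma sq_integrableB f g : sq_integrable f -> sq_integrable g ->
  sq_integrable (fun x => f x - g x).
Proof.
move=> sf /(sq_integrableZ (- 1)) sg.
have := sq_integrableD sf sg.
by under eq_fun do rewrite mulN1r.
Qed.

Lemma finite_measure_segment (a b : R) : ((leb R) `]a, b] < +oo)%E.
Proof. by rewrite lebesgue_measure_itv/=; case: ifP => _; rewrite ?ltry. Qed.

Lemma sq_integrable_integrable f D : measurable D -> ((leb R) D < +oo)%E ->
  sq_integrable f -> (leb R).-integrable D (EFin \o f).
Proof.
move=> mD Dfin [mf fi].
apply: (@integrable_le_norm _ _ (fun x => 1 + f x ^+ 2)) => //.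
- exact: measurable_funTS.
- by move=> x _; rewrite ler_norml; apply/andP; split; nra.
- apply: (@integrable_addr _ (cst 1%R)) => //.
    apply: (@measurable_bounded_integrable _ _ _ _ (cst 1%R)) => //.
    exact: bounded_cst.
  exact: integrableS fi.
Qed.

Lemma sq_integrable_loc f : sq_integrable f -> locally_integrable setT f.
Proof.
move=> sf; split; [by case: sf|exact: openT|move=> K _ cK].
have mK : measurable K by exact: compact_measurable.
have /integrableP[_] // : (leb R).-integrable K (EFin \o f).
by apply: sq_integrable_integrable => //; exact: compact_finite_measure.
Qed.

Lemma sq_integrable_indic D : measurable D -> ((leb R) D < +oo)%E ->
  sq_integrable \1_D.
Proof.
move=> mD Dfin; split => //.
apply: (@eq_integrable _ _ _ _ _ measurableT (EFin \o \1_D)).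
  by move=> x _ /=; rewrite indicE; case: (_ \in _); rewrite ?expr1n ?expr0n.
apply/integrableP; split; first exact/measurable_EFinP.
under eq_integral do rewrite gee0_abs// ?lee_fin//.
by rewrite integral_indic// setIT.
Qed.

(** Young's inequality without its factor 1/2; the weight [d] is left free so that each application
    can balance the two terms. *)
Lemma Rintegral_AMGM f g (d : R) : 0 < d -> sq_integrable f ->
  sq_integrable g ->
  `|\int[leb R]_x (f x * g x)| <=
    d * \int[leb R]_x (f x ^+ 2) + d^-1 * \int[leb R]_x (g x ^+ 2).
Proof.
move=> d0 sf sg.
have iM := sq_integrableM sf sg.
rewrite (le_trans (le_normr_Rintegral _ _))//.
rewrite -!RintegralZl//; try by [case: sf|case: sg].
have i1 : (leb R).-integrable setT (EFin \o (fun x => d * f x ^+ 2)).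
  by case: sf => _ /(integrable_scaler d measurableT).
have i2 : (leb R).-integrable setT (EFin \o (fun x => d^-1 * g x ^+ 2)).
  by case: sg => _ /(integrable_scaler d^-1 measurableT).
rewrite -RintegralD//; apply: le_Rintegral => //.
- exact: integrable_norm iM.
- exact: integrable_addr.
move=> x _ /=.
(* With d = e^2 the product is (e f)(e^-1 g), and |a b| <= a^2 + b^2 applies to these two
   factors. *)
have [e -> e0] : exists2 e, d = e ^+ 2 & 0 < e.
  by exists (Num.sqrt d); rewrite ?sqr_sqrtr ?sqrtr_gt0// ltW.
rewrite -exprVn -!exprMn.
have -> : f x * g x = (e * f x) * (e^-1 * g x).
  by rewrite mulrACA divff ?mul1r// gt_eqF.
move: (e * f x) (e^-1 * g x) => a b.
by rewrite ler_norml; apply/andP; split; nra.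
Qed.

End square_integrable.

(** * Integrals over half-open intervals *)

Section interval_integrals.
Context (R : realType).

Lemma ae_imp (P Q : R -> Prop) : (forall x, P x -> Q x) ->
  {ae leb R, forall x, P x} -> {ae leb R, forall x, Q x}.
Proof.
by move=> PQ; apply: filterS => //; exact: (ae_filter_ringOfSetsType (leb R)).
Qed.

Lemma ae_imp2 (P Q S : R -> Prop) : (forall x, P x -> Q x -> S x) ->
  {ae leb R, forall x, P x} -> {ae leb R, forall x, Q x} ->
  {ae leb R, forall x, S x}.
Proof.
by move=> PQ; apply: filterS2 => //; exact: (ae_filter_ringOfSetsType (leb R)).
Qed.

Implicit Types (f g : R -> R) (a b c : R).

Lemma Rintegral_dominated_cvg (f_ : nat -> R -> R) f g :
  (forall n, measurable_fun setT (f_ n)) ->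
  (forall x, f_ n x @[n --> \oo] --> f x) ->
  (leb R).-integrable setT (EFin \o g) ->
  (forall n x, `|f_ n x| <= g x) ->
  \int[leb R]_x f_ n x @[n --> \oo] --> \int[leb R]_x f x.
Proof.
move=> mf_ ff ig fg.
have mf : measurable_fun setT f.
  by apply: (@measurable_fun_cvg _ _ _ _ f_) => // x _; exact: ff.
have [fi _ cf] : [/\ (leb R).-integrable setT (EFin \o f),
    ([sequence \int[leb R]_x `|(f_ n x)%:E - (f x)%:E|]_n @ \oo --> 0)%E &
    ([sequence \int[leb R]_x (f_ n x)%:E]_n @ \oo --> \int[leb R]_x (f x)%:E)%E].
  apply: (@dominated_convergence _ _ _ (leb R) _ measurableT
    (fun n => EFin \o f_ n) (EFin \o f) (EFin \o g)) => //.
  - by move=> n; apply/measurable_EFinP; exact: mf_.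
  - by apply/measurable_EFinP; exact: mf.
  - by apply: aeW => x _; apply: cvg_EFin; [exact: nearW|exact: ff].
  - by apply: aeW => x n _ /=; rewrite lee_fin.
by apply: fine_cvg; rewrite fineK ?integrable_fin_num.
Qed.

Lemma locally_integrable_itv f a b : locally_integrable setT f ->
  (leb R).-integrable `]a, b] (EFin \o f).
Proof.
move=> [mf _ fi].
have H : (leb R).-integrable `[a, b] (EFin \o f).
  apply/integrableP; split.
    by apply/measurable_EFinP; exact: measurable_funTS.
  by apply: fi => //; exact: segment_compact.
by apply: integrableS H => //; apply: subset_itvr; rewrite bnd_simp.
Qed.

Lemma Rintegral_itv_cat f a b c : locally_integrable setT f ->
  a <= b -> b <= c ->
  \int[leb R]_(x in `]a, c]) f x =
  \int[leb R]_(x in `]a, b]) f x + \int[leb R]_(x in `]b, c]) f x.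
Proof.
move=> lf ab bc; rewrite -(@Rintegral_itvB _ f (BRight a) (BRight c) b).
- by rewrite addrC subrK.
- exact: locally_integrable_itv.
- by rewrite bnd_simp.
- by rewrite bnd_simp.
Qed.

(** [Rintegral_AMGM] against the indicator of []a, b]]. Optimizing over [d] would give twice the
    square root of (b - a) times the energy, so this plays the part of the Hoelder-1/2 bound for
    primitives of L^2 functions. *)
Lemma Rintegral_itv_le_AMGM f a b (d : R) : 0 < d -> sq_integrable f -> a <= b ->
  `|\int[leb R]_(x in `]a, b]) f x| <=
    d * \int[leb R]_x (f x ^+ 2) + d^-1 * (b - a).
Proof.
move=> d0 sf ab.
have s1 : sq_integrable (\1_(`]a, b]%classic) : R -> R).
  by apply: sq_integrable_indic => //; exact: finite_measure_segment.
have := Rintegral_AMGM d0 sf s1.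
have -> : \int[leb R]_x (f x * \1_(`]a, b]%classic) x) =
    \int[leb R]_(x in `]a, b]) f x.
  rewrite [RHS]Rintegral_mkcond; apply: eq_Rintegral => x _.
  by rewrite patchE indicE; case: ifP => _; rewrite ?mulr1 ?mulr0.
congr (_ <= _ + _ * _).
under eq_Rintegral => x _.
  rewrite indicE -natrX (_ : (_ ^ 2)%N = (x \in `]a, b]%classic)); last first.
    by case: (_ \in _).
  over.
rewrite /Rintegral integral_indic//= setIT lebesgue_measure_itv/= lte_fin.
by move: ab; rewrite le_eqVlt => /predU1P[->|->]//=; rewrite ltxx subrr.
Qed.

(** Lebesgue differentiation: at almost every [x], [f x] is the derivative at [x] of the primitive
    of [f] based at x - 1, and this primitive is zero. *)
Lemma locally_integrable_ae0 f : locally_integrable setT f ->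
  (forall a b, a < b -> \int[leb R]_(x in `]a, b]) f x = 0) ->
  {ae leb R, forall x, f x = 0}.
Proof.
move=> lf f0; move: (lf) => /lebesgue_differentiation.
apply: ae_imp => x lx.
have x1x : (BRight (x - 1) < BRight x)%O by rewrite bnd_simp ltrBlDr ltrDl.
have xx1 : x < x + 1 by rewrite ltrDl.
have [_ <-] :=
  FTC1_lebesgue_pt xx1 (locally_integrable_itv (x - 1) (x + 1) lf) x1x lx.
have -> : (fun y => \int[leb R]_(t in `]x - 1, y]) f t) = cst 0.
  apply/funext => y /=; have [xy|yx] := ltP (x - 1) y; first exact: f0.
  by rewrite set_itv_ge ?Rintegral_set0// bnd_simp -leNgt.
exact: derive1_cst.
Qed.

Lemma locally_integrable_ae_eq f g : locally_integrable setT f ->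
  locally_integrable setT g ->
  (forall a b, a < b ->
    \int[leb R]_(x in `]a, b]) f x = \int[leb R]_(x in `]a, b]) g x) ->
  {ae leb R, forall x, f x = g x}.
Proof.
move=> lf lg fg.
have := @locally_integrable_ae0 (f \- g) (locally_integrableB lf lg).
have H a b : a < b -> \int[leb R]_(x in `]a, b]) (f \- g) x = 0.
  move=> ab; rewrite RintegralB//; try exact: locally_integrable_itv.
  by rewrite fg// subrr.
by move=> /(_ H); apply: ae_imp => x /eqP; rewrite subr_eq0 => /eqP.
Qed.

End interval_integrals.

(** * Weak derivatives *)

Section bumps.
Context (R : realType).
Implicit Types (f g : R -> R) (a b c e t x : R).

(** The difference quotient at [h] is within C |h| of [f x]. In this form a piecewise quadratic
    function is differentiated without treating its break points separately. *)
Lemma is_derive_quadratic (F f : R -> R) (C : R) :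
  (forall x h, `|F (x + h) - F x - h * f x| <= C * h ^+ 2) ->
  forall x : R, is_derive x 1 F (f x).
Proof.
move=> FC x.
have C0 : 0 <= C by have := FC 0 1; rewrite expr1n mulr1; exact: le_trans.
suff H : h^-1 *: ((F \o shift x) (h *: 1) - F x) @[h --> 0^'] --> f x.
  by apply: DeriveDef; [apply/cvg_ex; exists (f x)|exact/cvg_lim].
apply/cvgrPdist_le => e e0; near=> h.
have h0 : h != 0 by near: h; exact: nbhs_dnbhs_neq.
have hC : `|h| * (C + 1) <= e.
  rewrite -ler_pdivlMr ?ltr_wpDl//; near: h.
  apply: (@dnbhs0_le _ R^o); rewrite divr_gt0// ltr_wpDl//.
rewrite /= /GRing.scale/= mulr1 (addrC h).
have -> : f x - h^-1 * (F (x + h) - F x) =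
    - h^-1 * (F (x + h) - F x - h * f x).
  by field.
rewrite normrM normrN normfV mulrC ler_pdivrMr ?normr_gt0//.
rewrite (le_trans (FC x h))// -(real_normK (num_real h)) expr2 mulrA.
rewrite ler_pM2r ?normr_gt0//.
by rewrite (le_trans _ hC)// mulrC ler_wpM2l// lerDl.
Unshelve. all: by end_near. Qed.

Let pos t : R := Num.max 0 t.

Let pos_quadratic t h : `|pos (t + h) ^+ 2 - pos t ^+ 2 - h * (2 * pos t)| <= h ^+ 2.
Proof.
rewrite /pos; case: (leP 0 t) => t0; case: (leP 0 (t + h)) => th0;
  rewrite ler_norml; apply/andP; split; nra.
Qed.

(* The primitive of the hat function on [0, 1] with integral 1: a C^1 function
   which is 0 on ]-oo, 0] and 1 on [1, +oo[. *)
Definition smoothstep t : R :=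
  2 * (pos t ^+ 2 - 2 * pos (t - 2^-1) ^+ 2 + pos (t - 1) ^+ 2).

(** The derivative of [smoothstep]: the tent supported on [0, 1] with peak value 2 at 1/2. *)
Definition hat t : R := 4 * (pos t - 2 * pos (t - 2^-1) + pos (t - 1)).

(** Each squared positive part has a remainder of at most h^2, and the coefficients are 2, 4 and 2
    in absolute value, whence 8. *)
Lemma smoothstep_quadratic t h :
  `|smoothstep (t + h) - smoothstep t - h * hat t| <= 8 * h ^+ 2.
Proof.
have := pos_quadratic t h.
have := pos_quadratic (t - 2^-1) h.
have := pos_quadratic (t - 1) h.
rewrite !(addrAC _ _ h) !ler_norml /smoothstep /hat.
by move=> /andP[? ?] /andP[? ?] /andP[? ?]; apply/andP; split; lra.
Qed.

Lemma smoothstep_le0 t : t <= 0 -> smoothstep t = 0.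
Proof.
move=> t0; rewrite /smoothstep /pos; case: (leP 0 t) => ?; case: (leP 0 (t - 2^-1)) => ?;
  case: (leP 0 (t - 1)) => ?; nra.
Qed.

Lemma smoothstep_ge1 t : 1 <= t -> smoothstep t = 1.
Proof.
move=> t0; rewrite /smoothstep /pos; case: (leP 0 t) => ?; case: (leP 0 (t - 2^-1)) => ?;
  case: (leP 0 (t - 1)) => ?; lra.
Qed.

Lemma hat_ge0 t : 0 <= hat t.
Proof.
rewrite /hat /pos; case: (leP 0 t) => ?; case: (leP 0 (t - 2^-1)) => ?;
  case: (leP 0 (t - 1)) => ?; lra.
Qed.

Lemma hat_out t : t <= 0 \/ 1 <= t -> hat t = 0.
Proof.
rewrite /hat /pos; case: (leP 0 t) => ?; case: (leP 0 (t - 2^-1)) => ?;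
  case: (leP 0 (t - 1)) => ?; lra.
Qed.

Lemma smoothstep_itv t : 0 <= smoothstep t <= 1.
Proof.
rewrite /smoothstep /pos.
by apply/andP; split; case: (leP 0 t) => ?; case: (leP 0 (t - 2^-1)) => ?;
  case: (leP 0 (t - 1)) => ?; nra.
Qed.

Lemma continuous_pos : continuous pos.
Proof. by move=> x; apply: continuous_max; [exact: cvg_cst|exact: cvg_id]. Qed.

Lemma continuous_hat : continuous hat.
Proof.
have cp c : continuous (fun x => pos (x - c)).
  move=> x; apply: (@continuous_comp _ _ _ (fun x => x - c) pos);
    last exact: continuous_pos.
  by apply: cvgB; [exact: cvg_id|exact: cvg_cst].
have c0 : continuous pos by exact: continuous_pos.
move=> x; apply: cvgM; first exact: cvg_cst.
apply: cvgD; last exact: cp.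
by apply: cvgB; [exact: c0|apply: cvgM; [exact: cvg_cst|exact: cp]].
Qed.

(** As [e] tends to 0 this tends to the indicator of []c, +oo[], with value 0 at [c] itself. A
    difference of two ramps thus approximates the indicator of []a, b]] with the right convention at
    both end points. *)
Definition ramp c e x : R := smoothstep ((x - c) / e).

Definition ramp' c e x : R := e^-1 * hat ((x - c) / e).

Lemma ramp_quadratic c e x h : 0 < e ->
  `|ramp c e (x + h) - ramp c e x - h * ramp' c e x| <= 8 * e^-2 * h ^+ 2.
Proof.
move=> e0; have := smoothstep_quadratic ((x - c) / e) (h / e).
rewrite /ramp /ramp' (_ : (x + h - c) / e = (x - c) / e + h / e); last first.
  by rewrite -mulrDl addrAC.
have -> : 8 * (h / e) ^+ 2 = 8 / e ^+ 2 * h ^+ 2.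
  by rewrite expr_div_n mulrCA mulrC.
by rewrite [h * (_ * _)]mulrA.
Qed.

Lemma continuous_ramp' c e : continuous (ramp' c e).
Proof.
move=> x; apply: cvgM; first exact: cvg_cst.
apply: (@continuous_comp _ _ _ (fun x => (x - c) / e) hat);
  last exact: continuous_hat.
by apply: cvgM; [apply: cvgB; [exact: cvg_id|exact: cvg_cst]|exact: cvg_cst].
Qed.

Lemma is_derive_ramp c e x : 0 < e -> is_derive x 1 (ramp c e) (ramp' c e x).
Proof.
move=> e0; apply: (is_derive_quadratic (C := 8 * e^-2)) => y h.
exact: ramp_quadratic.
Qed.

Lemma ramp'_ge0 c e x : 0 < e -> 0 <= ramp' c e x.
Proof. by move=> e0; rewrite mulr_ge0 ?invr_ge0 ?hat_ge0// ltW. Qed.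

Lemma ramp'_out c e x : 0 < e -> ~ `]c, c + e]%classic x -> ramp' c e x = 0.
Proof.
move=> e0 /=; rewrite in_itv/= => /negP; rewrite negb_and -!leNgt -!ltNge => xce.
rewrite /ramp' hat_out ?mulr0//; move: xce => /orP[xc|xc].
  by left; rewrite pmulr_lle0 ?invr_gt0// subr_le0.
by right; rewrite ler_pdivlMr// mul1r lerBrDl ltW.
Qed.

Lemma ramp_le c e x : 0 < e -> x <= c -> ramp c e x = 0.
Proof.
by move=> e0 xc; rewrite /ramp smoothstep_le0// pmulr_lle0 ?invr_gt0// subr_le0.
Qed.

Lemma ramp_ge c e x : 0 < e -> c + e <= x -> ramp c e x = 1.
Proof.
by move=> e0 xc; rewrite /ramp smoothstep_ge1// ler_pdivlMr// mul1r lerBrDl.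
Qed.

Lemma ramp_itv c e x : 0 <= ramp c e x <= 1.
Proof. exact: smoothstep_itv. Qed.

Lemma continuous_is_derive (F f : R -> R) :
  (forall x : R, is_derive x 1 F (f x)) -> continuous F.
Proof.
move=> Ff x; apply/differentiable_continuous/derivable1_diffP.
by have [] := Ff x.
Qed.

Lemma continuous_locally_integrable f : continuous f ->
  locally_integrable setT f.
Proof.
move=> cf; split; [|exact: openT|move=> K _ cK].
  by apply: continuous_measurable_fun; exact: cf.
have /integrableP[_] // : (leb R).-integrable K (EFin \o f).
by apply: continuous_compact_integrable => //; exact: continuous_subspaceT.
Qed.

Lemma Rintegral_ramp' c e : 0 < e ->
  \int[leb R]_(x in `]c, c + e]) ramp' c e x = 1.
Proof.
move=> e0.
have cr : continuous (ramp c e).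
  by apply: continuous_is_derive => x; exact: is_derive_ramp.
rewrite Rintegral_itv_obnd_cbnd; last first.
  apply: locally_integrable_itv.
  by apply: continuous_locally_integrable; exact: continuous_ramp'.
rewrite /Rintegral (@continuous_FTC2 _ _ (ramp c e)) ?ltrDl//=.
- by rewrite ramp_ge// ramp_le// subr0.
- by apply: continuous_subspaceT; exact: continuous_ramp'.
- split.
  + by move=> x _; have [] := is_derive_ramp c x e0.
  + by apply: cvg_at_right_filter; exact: cr.
  + by apply: cvg_at_left_filter; exact: cr.
- by move=> x _; rewrite derive1E; have [_] := is_derive_ramp c x e0.
Qed.

(** [ramp' c e] is a probability density on []c, c + e]], so the integral is an average of values of
    [f] within [d] of [f c]. *)
Lemma Rintegral_mul_ramp' f c e d : 0 < e -> locally_integrable setT f ->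
  (forall x, c < x <= c + e -> `|f x - f c| <= d) ->
  (leb R).-integrable setT (EFin \o (fun x => f x * ramp' c e x)) ->
  `|\int[leb R]_x (f x * ramp' c e x) - f c| <= d.
Proof.
move=> e0 lf fd fi.
have E : \int[leb R]_x (f x * ramp' c e x) =
    \int[leb R]_(x in `]c, c + e]) (f x * ramp' c e x).
  rewrite [RHS]Rintegral_mkcond; apply: eq_Rintegral => x _; rewrite patchE.
  by case: ifPn => //; rewrite notin_setE => /(ramp'_out e0) ->; rewrite mulr0.
have ir : (leb R).-integrable `]c, c + e] (EFin \o ramp' c e).
  apply: locally_integrable_itv.
  by apply: continuous_locally_integrable; exact: continuous_ramp'.
have fi' : (leb R).-integrable `]c, c + e] (EFin \o (fun x => f x * ramp' c e x)).
  exact: integrableS fi.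
have ifc : (leb R).-integrable `]c, c + e] (EFin \o (fun x => f c * ramp' c e x)).
  exact: integrable_scaler.
have -> : f c = \int[leb R]_(x in `]c, c + e]) (f c * ramp' c e x).
  by rewrite RintegralZl// Rintegral_ramp'// mulr1.
rewrite E -RintegralB//.
rewrite (le_trans (le_normr_Rintegral _ _))//; first exact: integrable_subr.
have -> : d = \int[leb R]_(x in `]c, c + e]) (d * ramp' c e x).
  by rewrite RintegralZl// Rintegral_ramp'// mulr1.
apply: le_Rintegral => //.
- by apply: integrable_norm => //; exact: integrable_subr.
- exact: integrable_scaler.
move=> x /=; rewrite in_itv/= => xc.
rewrite -mulrBl normrM (ger0_norm (ramp'_ge0 _ _ e0)).
by rewrite ler_wpM2r ?ramp'_ge0// fd.
Qed.

End bumps.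

Section weak_derivatives.
Context (R : realType).
Implicit Types (f g phi : R -> R) (a b c e x : R).

(** [M] bounds the support strictly. Since M < |x| is an open condition, [phi] vanishes near each
    such point, and so does its derivative. *)
Lemma test_function_supp phi : test_function phi ->
  exists2 M, 0 < M & forall x, M < `|x| -> phi x = 0 /\ derive1 phi x = 0.
Proof.
move=> [_ _ /compact_bounded[M [Mr MP]]].
exists (`|M| + 1) => [|x Mx]; first by rewrite ltr_wpDl.
have out y : `|M| + 1 < `|y| -> phi y = 0.
  move=> My; apply/eqP/negP => /negP py.
  have : closure [set x | phi x != 0] y by exact: subset_closure.
  have M1 : M < `|M| + 1 by rewrite (le_lt_trans (ler_norm _))// ltrDl.
  by move=> /(MP _ M1)/=; rewrite leNgt My.
split; first exact: out.
rewrite derive1E (@near_eq_derive _ _ _ _ (cst 0)) ?derive_cst//.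
have : \near x, `|M| + 1 < `|x|.
  by apply: (@cvgr_gt R _ (nbhs x) _ Num.norm `|x|) => //; exact: norm_continuous.
by apply: filterS => y /out.
Qed.

Lemma continuous_supp_bounded phi M : continuous phi ->
  (forall x, M < `|x| -> phi x = 0) -> exists B, forall x, `|phi x| <= B.
Proof.
move=> cphi phi0.
have M0 : - `|M| <= `|M| by rewrite lerNl (le_trans _ (normr_ge0 _))// oppr_le0.
have [|c _ cB] := @EVT_max _ (fun x => `|phi x|) _ _ M0.
  apply: continuous_subspaceT => x.
  by apply: continuous_comp; [exact: cphi|exact: norm_continuous].
exists `|phi c| => x; have [Mx|xM] := ltP `|M| `|x|.
  by rewrite phi0 ?normr0// (le_lt_trans (ler_norm _)).
by apply: cB; rewrite in_itv/= -ler_norml.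
Qed.

Lemma integrable_mul_supp f phi M : locally_integrable setT f ->
  continuous phi -> (forall x, M < `|x| -> phi x = 0) ->
  (leb R).-integrable setT (EFin \o (fun x => f x * phi x)).
Proof.
move=> lf cphi phi0; have [B phiB] := continuous_supp_bounded cphi phi0.
have [mf _ fi] := lf.
have H : (leb R).-integrable `[- `|M|, `|M|] (EFin \o f).
  apply/integrableP; split.
    by apply/measurable_EFinP; exact: measurable_funTS.
  by apply: fi => //; exact: segment_compact.
have H2 : (leb R).-integrable setT (EFin \o (f \_ `[- `|M|, `|M|])).
  by rewrite -restrict_EFin; apply/integrable_restrict => //=; rewrite setTI.
apply: (@integrable_le_norm _ _ _ (fun x => B * `|(f \_ `[- `|M|, `|M|]) x|)) => //.
- apply: measurable_funM => //.
  by apply: continuous_measurable_fun; exact: cphi.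
- move=> x _; rewrite normrM mulrC patchE.
  case: ifPn => [_|]; first by rewrite ler_wpM2r.
  rewrite notin_setE/= in_itv/= -ler_norml => /negP; rewrite -ltNge => Mx.
  by rewrite phi0 ?normr0 ?mul0r ?mulr0// (le_lt_trans (ler_norm _)).
- by apply: integrable_scaler => //; exact: integrable_norm.
Qed.

Lemma test_function_integrable f phi : locally_integrable setT f ->
  test_function phi ->
  (leb R).-integrable setT (EFin \o (fun x => f x * phi x)) /\
  (leb R).-integrable setT (EFin \o (fun x => f x * derive1 phi x)).
Proof.
move=> lf tphi; have [M _ phi0] := test_function_supp tphi.
have [dphi cphi' _] := tphi; split.
- apply: (@integrable_mul_supp _ _ M) => //; last by move=> x /phi0[].
  by move=> x; apply/differentiable_continuous/derivable1_diffP.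
- by apply: (@integrable_mul_supp _ _ M) => // x /phi0[].
Qed.

(** The coefficient [c] serves two uses: c = 1 for y = zeta + Id and c = -1 for U_n - U. *)
Lemma is_weak_derivative_linear f1 g1 f2 g2 c :
  is_weak_derivative f1 g1 -> is_weak_derivative f2 g2 ->
  is_weak_derivative (fun x => f1 x + c * f2 x) (fun x => g1 x + c * g2 x).
Proof.
move=> [lf1 lg1 d1] [lf2 lg2 d2].
have lZ f : locally_integrable setT f -> locally_integrable setT (fun x => c * f x).
  move=> [mf oT fi]; split => //; first exact: measurable_funM.
  move=> K KT cK; have mK : measurable K by exact: compact_measurable.
  have ifK : (leb R).-integrable K (EFin \o f).
    apply/integrableP; split; last exact: fi.
    by apply/measurable_EFinP; exact: measurable_funTS.
  by have /integrableP[] := integrable_scaler c mK ifK.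
split; [exact: locally_integrableD (lZ _ _)|exact: locally_integrableD (lZ _ _)|].
move=> phi tphi.
have [i1 j1] := test_function_integrable lf1 tphi.
have [i2 j2] := test_function_integrable lf2 tphi.
have [i3 _] := test_function_integrable lg1 tphi.
have [i4 _] := test_function_integrable lg2 tphi.
transitivity (\int[leb R]_x (f1 x * derive1 phi x) +
    c * \int[leb R]_x (f2 x * derive1 phi x)).
  rewrite -RintegralZl// -RintegralD//; last exact: integrable_scaler.
  by apply: eq_Rintegral => x _; rewrite mulrDl mulrA.
rewrite d1// d2// mulrN -opprD; congr (- _).
rewrite -RintegralZl// -RintegralD//; last exact: integrable_scaler.
by apply: eq_Rintegral => x _; rewrite mulrDl mulrA.
Qed.

(** Integration by parts on the segment of radius M + 1, where the boundary terms vanish because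
    [phi] is zero beyond [M]. *)
Lemma is_weak_derivative_id : is_weak_derivative (fun x => x) (cst 1 : R -> R).
Proof.
split.
- by apply: continuous_locally_integrable => x; exact: cvg_id.
- by apply: continuous_locally_integrable => x; exact: cvg_cst.
move=> phi tphi; have [M M0 phi0] := test_function_supp tphi.
have [dphi cphi' _] := tphi.
have cphi : continuous phi.
  by move=> x; apply/differentiable_continuous/derivable1_diffP.
have MM : - (M + 1) < M + 1 by rewrite gtrN// addr_gt0.
have E (h : R -> R) : (forall x, M < `|x| -> h x = 0) ->
    \int[leb R]_x h x = \int[leb R]_(x in `[- (M + 1), M + 1]) h x.
  move=> h0; rewrite [RHS]Rintegral_mkcond; apply: eq_Rintegral => x _.
  rewrite patchE; case: ifPn => //.
  rewrite notin_setE/= in_itv/= -ler_norml => /negP; rewrite -ltNge => Mx.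
  by rewrite h0// (lt_trans _ Mx)// ltrDl.
rewrite !E; [|by move=> x /phi0[->]; rewrite mulr0|
  by move=> x /phi0[_ ->]; rewrite mulr0].
rewrite (@Rintegration_by_parts _ (fun x => x) phi (cst 1)) //.
- have M1 : M < `|M + 1| by rewrite (lt_le_trans _ (ler_norm _))// ltrDl.
  have [-> _] := phi0 _ M1; have := phi0 (- (M + 1)); rewrite normrN => /(_ M1)[-> _].
  by rewrite !mulr0 subr0 sub0r.
- by apply: continuous_subspaceT => x; exact: cvg_cst.
- split; [by move=> x _; exact: derivable_id| |].
  + exact: cvg_at_right_filter.
  + exact: cvg_at_left_filter.
- by move=> x _; rewrite derive1_id.
- exact: continuous_subspaceT.
- split; [by move=> x _; exact: dphi| |].
  + by apply: cvg_at_right_filter; exact: cphi.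
  + by apply: cvg_at_left_filter; exact: cphi.
Qed.

End weak_derivatives.

(** * The fundamental theorem of calculus for weak derivatives *)

Section weak_ftc.
Context (R : realType).
Implicit Types (f g phi : R -> R) (a b c e x : R).

Lemma is_derive_plateau a b e x : 0 < e ->
  is_derive x 1 (fun x => ramp a e x - ramp b e x) (ramp' a e x - ramp' b e x).
Proof.
move=> e0; have Da := is_derive_ramp a x e0; have Db := is_derive_ramp b x e0.
exact: is_deriveB.
Qed.

Lemma test_function_plateau a b e : 0 < e -> a <= b ->
  test_function (fun x => ramp a e x - ramp b e x).
Proof.
move=> e0 ab; split.
- by move=> x; have [] := is_derive_plateau a b x e0.
- have -> : derive1 (fun x => ramp a e x - ramp b e x) =
      (fun x => ramp' a e x - ramp' b e x).
    apply/funext => x; rewrite derive1E.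
    by have [_] := is_derive_plateau a b x e0.
  by move=> x; apply: cvgB; exact: continuous_ramp'.
- apply: (@subclosed_compact _ _ `[a, b + e]%classic).
  + exact: closed_closure.
  + exact: segment_compact.
  + rewrite [X in _ `<=` X](closure_id _).1; last exact: itv_closed.
    apply: closureS => x /=; rewrite in_itv/=; apply: contraNT.
    rewrite negb_and -!ltNge => /orP[xa|bx].
      by rewrite !ramp_le ?subrr// ltW// (lt_le_trans xa).
    rewrite !ramp_ge ?subrr ?(ltW bx)//.
    by rewrite (le_trans _ (ltW bx))// lerD2r.
Qed.

(** The difference of the ramps at [a] and [b] is a test function. Its derivative averages [f] just
    right of [a] minus just right of [b], and the function itself tends to the indicator of []a,
    b]]. Continuity of [f] identifies the first limit, dominated convergence the second. *)
Lemma weak_derivative_itv f g a b : is_weak_derivative f g -> continuous f ->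
  a <= b -> f b - f a = \int[leb R]_(x in `]a, b]) g x.
Proof.
move=> [lf lg fg] cf ab.
pose e (n : nat) : R := n.+1%:R^-1.
have e0 n : 0 < e n by rewrite invr_gt0.
pose phi n x := ramp a (e n) x - ramp b (e n) x.
have tphi n : test_function (phi n) by exact: test_function_plateau.
have e_cvg : e @ \oo --> (0 : R) by exact: cvg_harmonic.
have dphi n : derive1 (phi n) = (fun x => ramp' a (e n) x - ramp' b (e n) x).
  apply/funext => x; rewrite derive1E.
  by have [_] := is_derive_plateau a b x (e0 n).
have ir c n : (leb R).-integrable setT (EFin \o (fun x => f x * ramp' c (e n) x)).
  apply: (@integrable_mul_supp _ _ _ (Num.max `|c| `|c + e n|)) => //.
    exact: continuous_ramp'.
  move=> x; rewrite gt_max => /andP[xc xe]; apply: ramp'_out => //=.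
  rewrite in_itv/= => /andP[cx xce]; move: xc xe.
  by case: (ler0P c) => ?; case: (ler0P (c + e n)) => ?; case: (ler0P x) => ?; lra.
have cvgf c : \int[leb R]_x (f x * ramp' c (e n) x) @[n --> \oo] --> f c.
  apply/cvgrPdist_le => d d0.
  have /cvgrPdist_le /(_ _ d0)/nbhs_ballP[r /= r0 fr] := cf c.
  near=> n; rewrite distrC; apply: Rintegral_mul_ramp' => // x /andP[cx xce].
  rewrite distrC; apply: fr; rewrite /ball/= ltr_distlC.
  have er : e n < r by near: n; exact: cvgr_lt e_cvg _ r0.
  by apply/andP; split; lra.
have L1 : \int[leb R]_x (f x * derive1 (phi n) x) @[n --> \oo] --> f a - f b.
  have -> : (fun n => \int[leb R]_x (f x * derive1 (phi n) x)) =
      (fun n => \int[leb R]_x (f x * ramp' a (e n) x) -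
                \int[leb R]_x (f x * ramp' b (e n) x)).
    apply/funext => n; rewrite -RintegralB//.
    by apply: eq_Rintegral => x _; rewrite dphi mulrBr.
  by apply: cvgB; exact: cvgf.
have L2 : \int[leb R]_x (g x * phi n x) @[n --> \oo] -->
    \int[leb R]_(x in `]a, b]) g x.
  rewrite [X in _ --> X]Rintegral_mkcond.
  have ig := locally_integrable_itv a (b + 1) lg.
  have ig' : (leb R).-integrable setT (EFin \o (g \_ `]a, b + 1])).
    by rewrite -restrict_EFin; apply/integrable_restrict => //=; rewrite setTI.
  (* All plateaus live in []a, b + 1]] because e n <= 1, so |g| restricted to this interval is a
     common majorant. *)
  apply: (@Rintegral_dominated_cvg _ _ _ (Num.norm \o (g \_ `]a, b + 1]))).
  - move=> n; apply: measurable_funM; first by case: lg.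
    apply: continuous_measurable_fun; have [d _ _] := tphi n.
    by move=> x; apply/differentiable_continuous/derivable1_diffP.
  - move=> x; rewrite patchE; case: ifPn.
      rewrite inE/= in_itv/= => /andP[ax xb].
      apply: cvg_near_cst; near=> n.
      rewrite /phi ramp_ge// ?(ramp_le _ xb) ?subr0 ?mulr1//.
      have : e n < x - a by near: n; apply: cvgr_lt e_cvg _ _; rewrite subr_gt0.
      by move=> ?; lra.
    rewrite notin_setE/= in_itv/= => /negP; rewrite negb_and -leNgt -ltNge.
    move=> /orP[xa|bx]; apply: cvg_near_cst; near=> n.
      by rewrite /phi !ramp_le// ?subr0 ?mulr0// (le_trans xa).
    have : e n < x - b by near: n; apply: cvgr_lt e_cvg _ _; rewrite subr_gt0.
    by move=> ?; rewrite /phi !ramp_ge// ?subrr ?mulr0//; lra.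
  - exact: integrable_norm.
  - move=> n x /=; rewrite patchE normrM.
    have e1 : e n <= 1 by rewrite invf_le1 // ler1n.
    case: ifPn => [_|].
      rewrite ler_piMr// /phi ler_norml.
      have /andP[] := ramp_itv a (e n) x; have /andP[] := ramp_itv b (e n) x.
      by move=> ? ? ? ?; apply/andP; split; lra.
    rewrite notin_setE/= in_itv/= => /negP; rewrite negb_and -leNgt -ltNge.
    move=> /orP[xa|bx]; rewrite normr0.
      by rewrite /phi !ramp_le// ?subr0 ?normr0 ?mulr0// (le_trans xa).
    by rewrite /phi !ramp_ge// ?subrr ?normr0 ?mulr0//; lra.
have : \int[leb R]_x (f x * derive1 (phi n) x) @[n --> \oo] -->
    - \int[leb R]_(x in `]a, b]) g x.
  under eq_fun do rewrite fg//.
  exact: cvgN.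
move/(cvg_unique (@Rhausdorff R) L1) => H.
by rewrite -[RHS]opprK -H opprB.
Unshelve. all: by end_near. Qed.

(** Both derivatives integrate to f b - f a over every []a, b]]. As [wderiv] picks some
    representative, this is how it is exchanged for an explicit one. *)
Lemma weak_derivative_unique f g h : continuous f ->
  is_weak_derivative f g -> is_weak_derivative f h ->
  {ae leb R, forall x, g x = h x}.
Proof.
move=> cf fg fh; apply: locally_integrable_ae_eq.
- by case: fg.
- by case: fh.
move=> a b /ltW ab.
by rewrite -(weak_derivative_itv fg)// -(weak_derivative_itv fh).
Qed.

Lemma wderivP f : weakly_differentiable f -> is_weak_derivative f (wderiv f).
Proof. by move=> H; exact: (xgetPex (cst 0) H). Qed.

Lemma wderiv_itv f a b : weakly_differentiable f -> continuous f -> a <= b ->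
  f b - f a = \int[leb R]_(x in `]a, b]) wderiv f x.
Proof. by move=> /wderivP; exact: weak_derivative_itv. Qed.

Lemma wderiv_linear f1 f2 c : continuous f1 -> continuous f2 ->
  weakly_differentiable f1 -> weakly_differentiable f2 ->
  {ae leb R, forall x, wderiv (fun x => f1 x + c * f2 x) x =
    wderiv f1 x + c * wderiv f2 x}.
Proof.
move=> cf1 cf2 /wderivP d1 /wderivP d2.
have d := is_weak_derivative_linear c d1 d2.
have w : weakly_differentiable (fun x => f1 x + c * f2 x) by eexists; exact: d.
apply: weak_derivative_unique (wderivP w) d.
by move=> x; apply: cvgD; [exact: cf1|apply: cvgM; [exact: cvg_cst|exact: cf2]].
Qed.

End weak_ftc.

(** * Weak convergence in L^2 *)

Import HBNNSimple.

Section weak_convergence.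
Context (R : realType) (v_ : nat -> R -> R) (C : R).
Hypothesis v_sq : forall n, sq_integrable (v_ n).
Hypothesis v_le : forall n, \int[leb R]_x (v_ n x ^+ 2) <= C.
Hypothesis v_itv : forall a b, a < b ->
  \int[leb R]_(x in `]a, b]) v_ n x @[n --> \oo] --> (0 : R).

(** The test functions against which [v_] tends to 0. The class is linear and stable under dominated
    pointwise limits, so it grows from intervals to bounded Borel sets, simple functions and finally
    all of L^2; square integrability is built in so that every closure step carries it along. *)
Definition weakly_null (g : R -> R) : Prop :=
  sq_integrable g /\ \int[leb R]_x (v_ n x * g x) @[n --> \oo] --> (0 : R).

Lemma weakly_null_linear g1 g2 c : weakly_null g1 -> weakly_null g2 ->
  weakly_null (fun x => g1 x + c * g2 x).
Proof.
move=> [s1 t1] [s2 t2]; split.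
  by apply: sq_integrableD => //; exact: sq_integrableZ.
have -> : (fun n => \int[leb R]_x (v_ n x * (g1 x + c * g2 x))) =
    (fun n => \int[leb R]_x (v_ n x * g1 x) + c * \int[leb R]_x (v_ n x * g2 x)).
  apply/funext => n.
  have i1 := sq_integrableM (v_sq n) s1; have i2 := sq_integrableM (v_sq n) s2.
  rewrite -RintegralZl// -RintegralD//; last exact: integrable_scaler.
  by apply: eq_Rintegral => x _; rewrite mulrDr mulrCA.
rewrite -(addr0 0) -{2}(mulr0 c).
by apply: cvgD => //; apply: cvgM => //; exact: cvg_cst.
Qed.

Lemma weakly_null0 : weakly_null (fun=> 0).
Proof.
split; last first.
  apply: cvg_near_cst; near=> n.
  by under eq_Rintegral do rewrite mulr0; rewrite Rintegral_cst// mul0r.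
split => //; under eq_fun do rewrite /= expr0n.
exact: integrable0.
Unshelve. all: by end_near. Qed.

Lemma weakly_null_sum k (c : nat -> R) (G : nat -> R -> R) :
  (forall i, weakly_null (G i)) ->
  weakly_null (fun x => \sum_(i < k) c i * G i x).
Proof.
move=> tG; elim: k => [|k IH].
  by under eq_fun do rewrite big_ord0; exact: weakly_null0.
under eq_fun do rewrite big_ord_recr/=.
exact: weakly_null_linear.
Qed.

(** Dominated convergence gives g_n -> g in L^2, and the energy bound [C] on [v_] makes replacing g
    by a single g_N cheap for all n at once. *)
Lemma weakly_null_dominated (g_ : nat -> R -> R) (g G : R -> R) :
  (forall n, weakly_null (g_ n)) -> (forall x, g_ n x @[n --> \oo] --> g x) ->
  sq_integrable G -> (forall n x, `|g_ n x| <= G x) -> weakly_null g.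
Proof.
move=> tg gg sG gG.
have mg : measurable_fun setT g.
  apply: (@measurable_fun_cvg _ _ _ _ g_) => [n|x _]; last exact: gg.
  by have [[]] := tg n.
have gG' x : `|g x| <= G x.
  apply: (@closed_cvg _ _ \oo _ (fun n => `|g_ n x|) (fun y => y <= G x)) => //.
  - by apply: nearW => n; exact: gG.
  - by apply: cvg_norm; exact: gg.
have sg : sq_integrable g.
  by apply: (sq_integrable_le mg _ sG) => x; rewrite (le_trans (gG' x)) ?ler_norm.
split => //.
have d0 : \int[leb R]_x ((g x - g_ n x) ^+ 2) @[n --> \oo] --> (0 : R).
  have -> : (0 : R) = \int[leb R]_x 0 by rewrite Rintegral_cst// mul0r.
  apply: (@Rintegral_dominated_cvg _ _ _ (fun x => 4 * G x ^+ 2)).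
  - by move=> n; apply: measurable_funX; apply: measurable_funB => //; have [[]] := tg n.
  - move=> x; under eq_fun do rewrite expr2.
    have z : g x - g_ n x @[n --> \oo] --> (0 : R).
      by rewrite -(subrr (g x)); apply: cvgB; [exact: cvg_cst|exact: gg].
    by have := cvgM z z; rewrite mulr0; exact.
  - by apply: integrable_scaler => //; case: sG.
  - move=> n x; rewrite ger0_norm ?sqr_ge0//.
    have := gG n x; have := gG' x; rewrite !ler_norml => /andP[? ?] /andP[? ?].
    nra.
apply/cvgrPdist_le => d dd0.
have C0 : 0 <= C.
  by rewrite (le_trans _ (v_le 0))// Rintegral_ge0// => x _; exact: sqr_ge0.
(* [d] is split in three: this weight bounds the energy term of Young's inequality by d / 3, a
   squared L^2 error of at most (d / 3) e bounds the other term, and the last third is for g_N. *)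
pose e := d / (3 * (C + 1)).
have e0 : 0 < e by rewrite divr_gt0// mulr_gt0// ltr_wpDl.
have d30 : 0 < d / 3 by rewrite divr_gt0.
have /cvgrPdist_le/(_ _ (mulr_gt0 d30 e0))[N _ HN] := d0.
have [sN tN] := tg N.
move/cvgrPdist_le : tN => /(_ _ d30) H.
near=> n.
have : `|0 - \int[leb R]_x (v_ n x * g_ N x)| <= d / 3 by near: n.
rewrite !sub0r !normrN => H0.
have -> : \int[leb R]_x (v_ n x * g x) =
    \int[leb R]_x (v_ n x * g_ N x) + \int[leb R]_x (v_ n x * (g x - g_ N x)).
  rewrite -RintegralD//; [|exact: sq_integrableM|].
    by apply: eq_Rintegral => x _; rewrite -mulrDr addrC subrK.
  by apply: sq_integrableM => //; exact: sq_integrableB.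
rewrite (le_trans (ler_normD _ _))//.
have := Rintegral_AMGM e0 (v_sq n) (sq_integrableB sg sN).
have := HN N (leqnn N); rewrite /= sub0r normrN ger0_norm; last first.
  by apply: Rintegral_ge0 => x _; exact: sqr_ge0.
move=> H1 H2.
have H3 : e * \int[leb R]_x (v_ n x ^+ 2) <= d / 3.
  rewrite (le_trans (ler_wpM2l (ltW e0) (v_le n)))// /e.
  have C1 : 0 < C + 1 by rewrite ltr_wpDl.
  have -> : d / (3 * (C + 1)) * C = d / 3 * (C / (C + 1)).
    by field; rewrite gt_eqF.
  by rewrite ler_piMr ?(ltW d30)// ler_pdivrMr ?mul1r ?lerDl.
have H4 : e^-1 * \int[leb R]_x ((g x - g_ N x) ^+ 2) <= d / 3.
  by rewrite mulrC ler_pdivrMr.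
lra.
Unshelve. all: by end_near. Qed.

Lemma weakly_null_itv a b : weakly_null \1_(`]a, b]%classic).
Proof.
have [ba|ab] := leP b a.
  rewrite set_itv_ge; last by rewrite bnd_simp -leNgt.
  by rewrite indic0; exact: weakly_null0.
split; first by apply: sq_integrable_indic => //; exact: finite_measure_segment.
suff -> : (fun n => \int[leb R]_x (v_ n x * \1_(`]a, b]%classic) x)) =
    (fun n => \int[leb R]_(x in `]a, b]) v_ n x) by exact: v_itv.
apply/funext => n; rewrite [RHS]Rintegral_mkcond; apply: eq_Rintegral => x _.
by rewrite patchE indicE; case: ifP; rewrite ?mulr1 ?mulr0.
Qed.

(** Dynkin's pi-lambda argument from the half-open intervals. The window []- M, M]] keeps every
    indicator in L^2, complements included. *)
Lemma weakly_null_indic (A : set (borelR R)) (M : R) : measurable A ->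
  weakly_null \1_(A `&` `]- M, M]%classic).
Proof.
pose I : set R := `]- M, M]%classic; rewrite -/I.
have sI : sq_integrable (\1_I : R -> R).
  apply: sq_integrable_indic; first exact: measurable_itv.
  exact: finite_measure_segment.
move=> mA; suff : forall S, <<s @ocitv R >> S -> weakly_null \1_(S `&` I).
  by apply; exact: mA.
apply: (@dynkin_induction _ (borelR R)) => //.
- exact: ocitvI.
- by rewrite setTI; exact: weakly_null_itv.
- move=> _ [[a b] _ <-]/=.
  have -> : `]a, b] `&` I = `]Num.max a (- M), Num.min b M]%classic.
    apply/predeqP => x; rewrite /I /= !in_itv/= gt_max le_min; split.
      by move=> [/andP[-> ->] /andP[-> ->]].
    by move=> /andP[/andP[-> ->] /andP[-> ->]].
  exact: weakly_null_itv.
- move=> S mS tS.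
  have -> : \1_(~` S `&` I) = (fun x => \1_I x + (-1) * \1_(S `&` I) x) :> (R -> R).
    apply/funext => x; rewrite !indicE !in_setI in_setC.
    by case: (x \in S); case: (x \in I); rewrite /= ?mulN1r ?subrr ?subr0 ?addr0.
  by apply: weakly_null_linear => //; exact: weakly_null_itv.
- move=> F mF tF nF.
  have sum1 n k x : (k < n)%N -> F k x ->
      \sum_(i < n) 1 * \1_(F i `&` I) x = \1_I x :> R.
    move=> kn Fkx; rewrite (bigD1 (Ordinal kn))//= big1 ?addr0 ?mul1r.
      by rewrite !indicE in_setI (mem_set Fkx).
    move=> i ik; rewrite indicE in_setI memNset ?mulr0// => Fix.
    move/eqP: ik; apply; apply: val_inj => /=.
    by apply: tF => //; exists x.
  have sum0 n x : (forall k, (k < n)%N -> ~ F k x) ->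
      \sum_(i < n) 1 * \1_(F i `&` I) x = 0 :> R.
    move=> nF'; rewrite big1// => i _.
    by rewrite indicE in_setI memNset ?mulr0//; exact: nF'.
  (* The sets are disjoint, so each partial sum is at most the indicator of the window, which serves
     as majorant. *)
  apply: (@weakly_null_dominated
    (fun n x => \sum_(i < n) 1 * \1_(F i `&` I) x) _ _ _ _ sI).
  + move=> n; exact: (@weakly_null_sum n (fun=> 1) (fun i => \1_(F i `&` I))).
  + move=> x; apply: cvg_near_cst.
    have [[k _ Fkx]|nFx] := pselect ((\bigcup_k F k) x).
      exists k.+1 => //= n /= kn; rewrite (sum1 _ k)//.
      by rewrite !indicE in_setI [in RHS]mem_set//; exists k.
    apply: nearW => n; rewrite sum0.
      by rewrite indicE in_setI memNset.
    by move=> k _ Fkx; apply: nFx; exists k.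
  + move=> n x; have [[k kn Fkx]|nFx] := pselect (exists2 k, (k < n)%N & F k x).
      by rewrite (sum1 _ k)// ger0_norm.
    rewrite sum0 ?normr0// => k kn Fkx.
    by apply: nFx; exists k.
Qed.

(** Simple functions increase to [g], but their level sets, that of 0 in particular, may have
    infinite measure. Cutting them to []-n, n]] brings the pieces within reach of
    [weakly_null_indic], and [g] itself dominates. *)
Lemma weakly_null_ge0 (g : R -> R) : sq_integrable g -> (forall x, 0 <= g x) ->
  weakly_null g.
Proof.
move=> sg g0; have [mg _] := sg.
have mg' : measurable_fun [set: borelR R] (EFin \o g) by apply/measurable_EFinP.
pose s := nnsfun_approx (measurableT : measurable [set: borelR R]) mg'.
have sg_cvg x : s n x @[n --> \oo] --> g x.
  have : EFin \o s ^~ x @ \oo --> (g x)%:E.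
    by apply: cvg_nnsfun_approx => // y _; rewrite lee_fin.
  by move/fine_cvg; exact.
have s_le n x : s n x <= g x.
  rewrite -(cvg_lim (@Rhausdorff R) (sg_cvg x)).
  apply: (@nondecreasing_cvgn_le _ (s ^~ x)).
    by move=> a b ab; exact/lefP/nd_nnsfun_approx.
  by apply/cvg_ex; exists (g x); exact: sg_cvg.
pose I (n : nat) := `]- n%:R, n%:R : R]%classic.
apply: (@weakly_null_dominated (fun n x => s n x * \1_(I n) x) _ _ _ _ sg).
- move=> n.
  have [k [c sE]] : exists k (c : nat -> R),
      forall x, s n x = \sum_(i < k) c i * \1_(s n @^-1` [set c i]) x.
    by do 2 eexists; exact: fimfunEord.
  have -> : (fun x => s n x * \1_(I n) x) = (fun x =>
      \sum_(i < k) c i * \1_(s n @^-1` [set c i] `&` I n) x).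
    apply/funext => x; rewrite sE mulr_suml; apply: eq_bigr => i _.
    rewrite -mulrA; congr (_ * _).
    by rewrite !indicE in_setI -natrM mulnb.
  apply: (@weakly_null_sum _ c (fun i => \1_(s n @^-1` [set c i] `&` I n))) => i.
  exact: weakly_null_indic.
- move=> x; rewrite -[g x]mulr1; apply: cvgM; first exact: sg_cvg.
  apply: cvg_near_cst; near=> n.
  have xn : `|x| < n%:R by near: n; exact: nbhs_infty_gtr.
  have xI : I n x.
    by rewrite /I/= in_itv/=; move: xn; rewrite ltr_norml => /andP[-> /ltW].
  by rewrite indicE mem_set.
- move=> n x; rewrite normrM ger0_norm// indicE normr_nat.
  by case: (_ \in _); rewrite ?mulr1 ?mulr0.
Unshelve. all: by end_near. Qed.

Lemma weakly_nullT (g : R -> R) : sq_integrable g -> weakly_null g.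
Proof.
move=> sg; have [mg _] := sg.
have -> : g = (fun x => Num.max (g x) 0 + (-1) * Num.max (- g x) 0).
  by apply/funext => x; case: (lerP (g x) 0); case: (lerP (- g x) 0); lra.
apply: weakly_null_linear; apply: weakly_null_ge0.
- apply: (sq_integrable_le _ _ sg); first exact: measurable_maxr.
  move=> x; rewrite ger0_norm ?le_max ?lexx ?orbT//.
  by rewrite ge_max ler_norm normr_ge0.
- by move=> x; rewrite le_max lexx orbT.
- apply: (sq_integrable_le _ _ sg).
    by apply: measurable_maxr => //; exact: measurableT_comp.
  move=> x; rewrite ger0_norm ?le_max ?lexx ?orbT//.
  by rewrite ge_max normr_ge0 -normrN ler_norm.
- by move=> x; rewrite le_max lexx orbT.
Qed.

End weak_convergence.

Lemma weak_cvg_L2_of_itv (R : realType) (w_ : nat -> R -> R) (w : R -> R) (C : R) :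
  (forall n, sq_integrable (w_ n)) -> sq_integrable w ->
  (forall n, \int[leb R]_x (w_ n x ^+ 2) <= C) ->
  (forall a b, a < b -> \int[leb R]_(x in `]a, b]) w_ n x @[n --> \oo] -->
    \int[leb R]_(x in `]a, b]) w x) ->
  weak_cvg_L2 w_ w.
Proof.
move=> sw_ sw wC wi g /in_Lp2P sg.
have sv n : sq_integrable (fun x => w_ n x - w x) by exact: sq_integrableB.
have vC n : \int[leb R]_x ((w_ n x - w x) ^+ 2) <=
    2 * C + 2 * \int[leb R]_x (w x ^+ 2).
  rewrite (@le_trans _ _ (2 * \int[leb R]_x (w_ n x ^+ 2) +
    2 * \int[leb R]_x (w x ^+ 2)))//; last by rewrite lerD2r ler_wpM2l.
  have [_ i1] := sw_ n; have [_ i2] := sw.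
  rewrite -!RintegralZl// -RintegralD//; try exact: integrable_scaler.
  apply: le_Rintegral => //; first by case: (sv n).
    by apply: integrable_addr => //; exact: integrable_scaler.
  by move=> x _; move: (w_ n x) (w x) => a b; have := sqr_ge0 (a + b); nra.
have vi a b : a < b -> \int[leb R]_(x in `]a, b]) (w_ n x - w x) @[n --> \oo]
    --> (0 : R).
  move=> ab.
  have -> : (fun n => \int[leb R]_(x in `]a, b]) (w_ n x - w x)) =
      (fun n => \int[leb R]_(x in `]a, b]) w_ n x -
                \int[leb R]_(x in `]a, b]) w x).
    apply/funext => n; rewrite RintegralB//.
    + by apply: sq_integrable_integrable => //; exact: finite_measure_segment.
    + by apply: sq_integrable_integrable => //; exact: finite_measure_segment.
  by apply/subr_cvg0; exact: wi.
have [_ H] := weakly_nullT sv vC vi sg.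
apply/subr_cvg0.
suff -> : (fun n => \int[leb R]_x (w_ n x * g x) - \int[leb R]_x (w x * g x)) =
    (fun n => \int[leb R]_x ((w_ n x - w x) * g x)) by exact: H.
apply/funext => n; rewrite -RintegralB//; try exact: sq_integrableM.
by apply: eq_Rintegral => x _; rewrite mulrBl.
Qed.

(** * Substitution along the characteristics y *)

Lemma Rintegral_cst_itv (R : realType) (a b c : R) : a <= b ->
  \int[leb R]_(x in `]a, b]) c = c * (b - a).
Proof.
move=> ab; rewrite Rintegral_cst//=; congr (_ * _).
rewrite lebesgue_measure_itv/= lte_fin.
by move: ab; rewrite le_eqVlt => /predU1P[->|->]//; rewrite ltxx subrr.
Qed.

Section change_of_variables.
Context (R : realType) (h y : R -> R) (K : R).
Hypothesis mh : measurable_fun setT h.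
Hypothesis h01 : forall x, 0 <= h x <= 1.
Hypothesis yE : forall a b, a <= b ->
  y b - y a = \int[leb R]_(x in `]a, b]) (1 - h x).
Hypothesis yK : forall x, `|y x - x| <= K.

Let d x := 1 - h x.

Let d0 x : 0 <= d x.
Proof. by have /andP[_] := h01 x; rewrite /d; lra. Qed.

Let d1 x : d x <= 1.
Proof. by have /andP[] := h01 x; rewrite /d; lra. Qed.

Let md : measurable_fun setT d.
Proof. exact: measurable_funB. Qed.

Let di a b : (leb R).-integrable `]a, b] (EFin \o d).
Proof.
apply: (@integrable_le_norm _ _ _ (cst 1)) => //.
- exact: measurable_funTS.
- by move=> x _ /=; rewrite ger0_norm.
- apply: (@measurable_bounded_integrable _ _ _ _ (cst 1)) => //.
    exact: finite_measure_segment.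
  exact: bounded_cst.
Qed.

Lemma flow_mono a b : a <= b -> y a <= y b.
Proof.
by move=> ab; rewrite -subr_ge0 yE// Rintegral_ge0// => x _; exact: d0.
Qed.

Lemma flow_lip a b : a <= b -> y b - y a <= b - a.
Proof.
move=> ab; rewrite yE//.
rewrite -[b - a]mul1r -Rintegral_cst_itv//.
have i1 : (leb R).-integrable `]a, b] (EFin \o cst (1 : R)).
  apply: measurable_bounded_integrable => //.
    exact: finite_measure_segment.
  exact: bounded_cst.
have i2 := di a b.
exact: (@le_Rintegral _ _ _ (leb R) _ d).
Qed.

Lemma continuous_flow : continuous y.
Proof.
move=> x; apply/cvgrPdist_le => e e0; near=> z.
have : `|x - z| <= e by near: z; exact: cvgr_dist_le.
have [xz|zx] := leP x z.
  rewrite distrC ger0_norm ?subr_ge0// => H.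
  rewrite distrC ger0_norm ?subr_ge0 ?flow_mono//.
  by rewrite (le_trans (flow_lip xz)).
rewrite ger0_norm ?subr_ge0 ?(ltW zx)// => H.
rewrite ger0_norm ?subr_ge0 ?flow_mono ?(ltW zx)//.
by rewrite (le_trans (flow_lip (ltW zx))).
Unshelve. all: by end_near. Qed.

Lemma measurable_flow : measurable_fun setT y.
Proof. by apply: continuous_measurable_fun; exact: continuous_flow. Qed.

(** [s] is the supremum of the sublevel set, which is nonempty and bounded above since |y - Id| <=
    K; the 1-Lipschitz bound shows that the value [x] is attained there. So [s] is the right end of
    the fibre, and preimages of half-open intervals are half-open. *)
Lemma flow_fibre x : exists s, y s = x /\ forall t, (y t <= x) = (t <= s).
Proof.
pose S := [set t | y t <= x].
have S0 : S (x - K).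
  rewrite /S/=; have := yK (x - K); rewrite ler_norml => /andP[_].
  by lra.
have Sub : ubound S (x + K).
  move=> t; rewrite /S/= => tx; have := yK t; rewrite ler_norml => /andP[].
  by lra.
have hS : has_sup S by split; [exists (x - K)|exists (x + K)].
have ys : y (sup S) = x.
  apply/eqP; rewrite eq_le; apply/andP; split; apply/ler_addgt0Pr => e e0.
    have [t St ts] := sup_adherent e0 hS.
    have tS : t <= sup S by exact: ub_le_sup (proj2 hS) _ St.
    have := flow_lip tS; move: St; rewrite /S/= => St.
    by lra.
  rewrite leNgt; apply/negP => ye.
  have : S (sup S + e).
    rewrite /S/=; have := @flow_lip (sup S) (sup S + e).
    by rewrite lerDl (ltW e0) => /(_ isT); lra.
  by move/(ub_le_sup (proj2 hS)); rewrite gerDl leNgt e0.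
exists (sup S); split => // t; apply/idP/idP => [tx|ts].
  exact: (ub_le_sup (proj2 hS)).
by rewrite -ys flow_mono.
Qed.

(** The right side is a measure in [A], and on []a, b]] its value is y t - y s = b - a, with [s] and
    [t] the right ends of the fibres over [a] and [b]. Uniqueness of Lebesgue measure does the
    rest. *)
Lemma flow_measure (A : set (borelR R)) : measurable A ->
  (leb R) A = (\int[leb R]_(x in y @^-1` A) (1 - h x)%:E)%E.
Proof.
pose nu A := (\int[leb R]_(x in y @^-1` A) (d x)%:E)%E.
have nu0 : nu set0 = 0%E by rewrite /nu preimage_set0 integral_set0.
have nu_ge0 A' : (0 <= nu A')%E by apply: integral_ge0 => x _; rewrite lee_fin.
have mpre (B : set (borelR R)) :
    measurable B -> measurable (y @^-1` B : set (borelR R)).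
  by move=> mB; rewrite -[X in measurable X]setTI; exact: measurable_flow.
have mdE : measurable_fun [set: borelR R] (EFin \o d) by apply/measurable_EFinP.
have nu_sigma : semi_sigma_additive (nu : set (borelR R) -> \bar R).
  move=> F mF tF mUF; rewrite /nu preimage_bigcup.
  apply: (semi_sigma_additive_nng_induced mdE) => //.
  - by move=> n; exact: mpre.
  - apply/trivIsetP => i j _ _ ij; rewrite -preimage_setI.
    by move/trivIsetP : tF => /(_ i j I I ij) ->; rewrite preimage_set0.
  - by rewrite -preimage_bigcup; exact: mpre.
pose nu_mix := isMeasure.Build _ _ _ (nu : set (borelR R) -> \bar R)
  nu0 nu_ge0 nu_sigma.
pose nu' : {measure set (borelR R) -> \bar R} := HB.pack nu nu_mix.
apply: (@lebesgue_measure_unique _ nu') => _ [[a b] _ <-]/=.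
rewrite /nu.
have [ba|ab] := leP b a.
  rewrite set_itv_ge; last by rewrite bnd_simp -leNgt.
  by rewrite preimage_set0 integral_set0 measure0.
have [s [ysa sa]] := flow_fibre a; have [t [ytb tb]] := flow_fibre b.
have st : s <= t by rewrite -tb ysa ltW.
have -> : y @^-1` `]a, b] = `]s, t]%classic.
  by apply/predeqP => x /=; rewrite !in_itv/= ltNge sa -ltNge tb.
rewrite lebesgue_measure_itv/= lte_fin ab -EFinB -ysa -ytb yE//.
by rewrite /Rintegral fineK// integrable_fin_num//; exact: di.
Qed.

End change_of_variables.

(** * Integration along the flow *)

Section flow_substitution.
Context (R : realType) (h y : R -> R) (K : R).
Hypothesis mh : measurable_fun setT h.
Hypothesis h01 : forall x, 0 <= h x <= 1.
Hypothesis yE : forall a b, a <= b ->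
  y b - y a = \int[leb R]_(x in `]a, b]) (1 - h x).
Hypothesis yK : forall x, `|y x - x| <= K.

Let d x := 1 - h x.

Let d0 x : 0 <= d x.
Proof. by have /andP[_] := h01 x; rewrite /d; lra. Qed.

Let d1 x : d x <= 1.
Proof. by have /andP[] := h01 x; rewrite /d; lra. Qed.

Let md : measurable_fun setT d.
Proof. exact: measurable_funB. Qed.

Let my : measurable_fun setT y.
Proof. exact: measurable_flow mh h01 yE. Qed.

Let mfy (f : R -> R) : measurable_fun setT f ->
  measurable_fun setT (fun x => f (y x) * d x).
Proof. by move=> mf; apply: measurable_funM => //; exact: measurableT_comp. Qed.

(** The coefficients enumerated for a nonnegative simple function are not known to be nonnegative
    one by one, but a negative one has an empty level set; the second hypothesis records this. *)
Let flow_indic (A : set (borelR R)) (c : R) : measurable A ->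
  (c < 0 -> A = set0) ->
  (\int[leb R]_x (c * \1_A x)%:E =
   \int[leb R]_x (c * (\1_A (y x) * d x))%:E)%E.
Proof.
move=> mA cA; have [clt|cge] := ltP c 0.
  by rewrite cA// indic0; under [RHS]eq_integral do rewrite /= mul0r.
under eq_integral do rewrite EFinM.
under [RHS]eq_integral do rewrite EFinM.
rewrite ge0_integralZl_EFin//; last first.
  by apply/measurable_EFinP; exact: measurable_indic.
rewrite ge0_integralZl_EFin//; last 2 first.
  by move=> x _; rewrite lee_fin mulr_ge0.
  by apply/measurable_EFinP; apply: mfy; exact: measurable_indic.
congr (_ * _)%E; rewrite integral_indic// setIT.
rewrite /= (flow_measure mh h01 yE yK mA) integral_mkcond.
apply: eq_integral => x _; rewrite patchE indicE.
case: ifPn => [/set_mem xA|/negP xA]; first by rewrite mem_set// mul1r.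
by rewrite memNset ?mul0r// => yxA; apply: xA; exact: mem_set.
Qed.

Import HBNNSimple.

(** [flow_measure] gives indicators, linearity gives simple functions, and monotone convergence is
    applied to both sides. *)
Lemma ge0_flow_substitution (f : R -> R) : measurable_fun setT f ->
  (forall x, 0 <= f x) ->
  (\int[leb R]_x (f (y x) * (1 - h x))%:E = \int[leb R]_x (f x)%:E)%E.
Proof.
move=> mf f0.
have mf' : measurable_fun [set: borelR R] (EFin \o f) by apply/measurable_EFinP.
pose s := nnsfun_approx (measurableT : measurable [set: borelR R]) mf'.
have s_cvg x : (s n x)%:E @[n --> \oo] --> (f x)%:E.
  by apply: cvg_nnsfun_approx => // z _; rewrite lee_fin.
have s_nd x m n : (m <= n)%N -> s m x <= s n x.
  by move=> mn; exact/lefP/nd_nnsfun_approx.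
have ms n : measurable_fun [set: borelR R] (s n) by exact: measurable_funPT.
have sE n : (\int[leb R]_x (s n x)%:E =
    \int[leb R]_x (s n (y x) * d x)%:E)%E.
  have [k [c sc]] : exists k (c : nat -> R),
      forall x, s n x = \sum_(i < k) c i * \1_(s n @^-1` [set c i]) x.
    by do 2 eexists; exact: fimfunEord.
  have mA i : measurable (s n @^-1` [set c i] : set (borelR R)).
    exact: measurable_funPTI.
  have c0 i x : 0 <= c i * \1_(s n @^-1` [set c i]) x.
    by have := nnfun_muleindic_ge0 (s n) (c i) x; rewrite -EFinM lee_fin.
  transitivity (\int[leb R]_x
      \sum_(i < k) (c i * \1_(s n @^-1` [set c i]) x)%:E)%E.
    by apply: eq_integral => x _; rewrite sc sumEFin.
  rewrite ge0_integral_sum//; last 2 first.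
    by move=> i; apply/measurable_EFinP; exact: measurable_funM.
    by move=> i x _; rewrite lee_fin.
  transitivity (\sum_(i < k) \int[leb R]_x
      (c i * (\1_(s n @^-1` [set c i]) (y x) * d x))%:E)%E.
    apply: eq_bigr => i _; apply: flow_indic => // ci0.
    exact: preimage_nnfun0.
  rewrite -ge0_integral_sum//.
  - apply: eq_integral => x _; rewrite sumEFin sc mulr_suml; congr EFin.
    by apply: eq_bigr => i _; rewrite mulrA.
  - move=> i; apply/measurable_EFinP; apply: measurable_funM => //.
    by apply: mfy; apply: measurable_indic; exact: mA.
  - by move=> i x _; rewrite lee_fin mulrA mulr_ge0.
have L1 : (\int[leb R]_x (s n x)%:E @[n --> \oo] --> \int[leb R]_x (f x)%:E)%E.
  have := @cvg_monotone_convergence _ _ _ (leb R) _ measurableT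
    (fun n x => (s n x)%:E).
  move=> /(_ _ _ _)/cvg_trans; apply.
  - by move=> n; apply/measurable_EFinP; exact: ms.
  - by move=> n x _; rewrite lee_fin.
  - by move=> x _ m n mn; rewrite lee_fin s_nd.
  rewrite (_ : (\int[leb R]_x _)%E = (\int[leb R]_x (f x)%:E)%E) //.
  by apply: eq_integral => x _; apply/cvg_lim => //; exact: s_cvg.
have L2 : (\int[leb R]_x (s n (y x) * d x)%:E @[n --> \oo] -->
    \int[leb R]_x (f (y x) * d x)%:E)%E.
  have := @cvg_monotone_convergence _ _ _ (leb R) _ measurableT
    (fun n x => (s n (y x) * d x)%:E).
  move=> /(_ _ _ _)/cvg_trans; apply.
  - by move=> n; apply/measurable_EFinP; apply: mfy; exact: ms.
  - by move=> n x _; rewrite lee_fin mulr_ge0.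
  - by move=> x _ m n mn; rewrite lee_fin ler_wpM2r// s_nd.
  rewrite (_ : (\int[leb R]_x _)%E = (\int[leb R]_x (f (y x) * d x)%:E)%E) //.
  apply: eq_integral => x _; apply/cvg_lim => //.
  under eq_fun do rewrite EFinM; rewrite EFinM.
  by apply: cvgeZr => //; exact: s_cvg.
apply/esym; apply: (cvg_unique _ L1) => //.
by rewrite /= (_ : (fun n => _) = fun n => (\int[leb R]_x (s n (y x) * d x)%:E)%E);
  last by apply/funext => n; exact: sE.
Qed.

Lemma flow_substitution (f : R -> R) :
  (leb R).-integrable setT (EFin \o f) ->
  (leb R).-integrable setT (EFin \o (fun x => f (y x) * (1 - h x))) /\
  \int[leb R]_x (f (y x) * (1 - h x)) = \int[leb R]_x f x.
Proof.
move=> fi.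
have mf : measurable_fun setT f.
  by apply/measurable_EFinP; case/integrableP : fi.
have key (g : R -> R) : measurable_fun setT g -> (forall x, 0 <= g x) ->
    (forall x, g x <= `|f x|) ->
    [/\ (leb R).-integrable setT (EFin \o g),
      (leb R).-integrable setT (EFin \o (fun x => g (y x) * d x)) &
      \int[leb R]_x (g (y x) * d x) = \int[leb R]_x g x].
  move=> mg g0 gf.
  have ig : (leb R).-integrable setT (EFin \o g).
    apply: (@integrable_le_norm _ _ _ (Num.norm \o f)) => //.
      by move=> x _; rewrite ger0_norm.
    exact: integrable_norm.
  split => //; last by rewrite /Rintegral ge0_flow_substitution.
  apply/integrableP; split; first by apply/measurable_EFinP; exact: mfy.
  under eq_integral do rewrite /= ger0_norm ?mulr_ge0//.
  rewrite ge0_flow_substitution//; case/integrableP : ig => _.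
  by under eq_integral do rewrite /= ger0_norm//.
have [i1 j1 E1] : [/\ (leb R).-integrable setT (EFin \o (fun x => Num.max (f x) 0)),
      (leb R).-integrable setT (EFin \o (fun x => Num.max (f (y x)) 0 * d x)) &
      \int[leb R]_x (Num.max (f (y x)) 0 * d x) = \int[leb R]_x Num.max (f x) 0].
  apply: (key (fun x => Num.max (f x) 0)); first exact: measurable_maxr.
    by move=> x; rewrite le_max lexx orbT.
  by move=> x; rewrite ge_max ler_norm normr_ge0.
have [i2 j2 E2] : [/\ (leb R).-integrable setT (EFin \o (fun x => Num.max (- f x) 0)),
      (leb R).-integrable setT (EFin \o (fun x => Num.max (- f (y x)) 0 * d x)) &
      \int[leb R]_x (Num.max (- f (y x)) 0 * d x) = \int[leb R]_x Num.max (- f x) 0].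
  apply: (key (fun x => Num.max (- f x) 0)).
  - by apply: measurable_maxr => //; exact: measurableT_comp.
  - by move=> x; rewrite le_max lexx orbT.
  - by move=> x; rewrite ge_max normr_ge0 -normrN ler_norm.
have max2 (a : R) : a = Num.max a 0 - Num.max (- a) 0.
  by case: (lerP a 0); case: (lerP (- a) 0); lra.
have -> : (fun x => f (y x) * (1 - h x)) =
    (fun x => Num.max (f (y x)) 0 * d x - Num.max (- f (y x)) 0 * d x).
  by apply/funext => x; rewrite -mulrBl -max2.
split; first exact: integrable_subr.
transitivity (\int[leb R]_x (Num.max (f x) 0 - Num.max (- f x) 0)).
  by rewrite RintegralB// [RHS]RintegralB// E1 E2.
by apply: eq_Rintegral => x _; rewrite -max2.
Qed.

(** A singleton is Lebesgue-null, so substitution in its indicator gives a zero integral for the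
    nonnegative 1 - h over the fibre. *)
Lemma flow_fibre_ae c : {ae leb R, forall x, y x = c -> h x = 1}.
Proof.
have m1 : measurable_fun setT (\1_[set c] : R -> R) by exact: measurable_indic.
have m2 : measurable_fun [set: borelR R]
    (fun x => (\1_[set c] (y x) * (1 - h x))%:E).
  by apply/measurable_EFinP; exact: mfy.
have E : (\int[leb R]_x `|(\1_[set c] (y x) * (1 - h x))%:E| = 0)%E.
  under eq_integral do rewrite gee0_abs ?lee_fin ?mulr_ge0 ?d0//.
  by rewrite ge0_flow_substitution// integral_indic//= setIT lebesgue_measure_set1.
have := (ae_eq_integral_abs (leb R) measurableT m2).1 E.
apply: ae_imp => x /(_ I)/= + yx; rewrite yx indicE mem_set// mul1r.
by move=> [] /eqP; rewrite subr_eq0 => /eqP.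
Qed.

End flow_substitution.

Lemma Rintegral_ae_eq (R : realType) (f g : R -> R) :
  measurable_fun setT f -> measurable_fun setT g ->
  {ae leb R, forall x, f x = g x} -> \int[leb R]_x f x = \int[leb R]_x g x.
Proof.
move=> mf mg fg; rewrite /Rintegral; congr fine; apply: ae_eq_integral => //.
- by apply/measurable_EFinP; exact: mf.
- by apply/measurable_EFinP; exact: mg.
- by apply: ae_imp fg => x -> _.
Qed.

(** * Densities transported by the flow *)

Section flow_density.
Context (R : realType) (h y : R -> R) (K : R).
Hypothesis mh : measurable_fun setT h.
Hypothesis h01 : forall x, 0 <= h x <= 1.
Hypothesis yE : forall a b, a <= b ->
  y b - y a = \int[leb R]_(x in `]a, b]) (1 - h x).
Hypothesis yK : forall x, `|y x - x| <= K.

Let my : measurable_fun setT y.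
Proof. exact: measurable_flow mh h01 yE. Qed.

Let md : measurable_fun setT (fun x => 1 - h x).
Proof. exact: measurable_funB. Qed.

(* The set y^-1(]y a, y b]) differs from ]a, b] only inside two fibres of y,
   on which h = 1 almost everywhere. *)
Lemma flow_itv_ae (V : R -> R) a b : {ae leb R, forall x, h x = 1 -> V x = 0} ->
  a <= b -> {ae leb R, forall x,
    V x * \1_(`]y a, y b]%classic) (y x) = V x * \1_(`]a, b]%classic) x}.
Proof.
move=> V0 ab.
have yab := flow_mono h01 yE ab.
have A := flow_fibre_ae mh h01 yE yK (y a).
have B := flow_fibre_ae mh h01 yE yK (y b).
have AB : {ae leb R, forall x, (y x = y a -> h x = 1) /\ (y x = y b -> h x = 1)}.
  by apply: ae_imp2 A B => x.
apply: ae_imp2 AB V0 => x [xa xb] V0.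
have [V1|V1] := eqVneq (V x) 0; first by rewrite V1 !mul0r.
have h1 : h x <> 1 by move=> /V0 /eqP; exact/negP.
have nya : y x != y a by apply/eqP => /xa.
have nyb : y x != y b by apply/eqP => /xb.
rewrite !indicE.
have E : (y a < y x <= y b) = (a < x <= b).
  apply/idP/idP => /andP[].
  - move=> ax xb'; apply/andP; split.
      by rewrite ltNge; apply/negP => /(flow_mono h01 yE); rewrite leNgt ax.
    rewrite leNgt; apply/negP => /ltW /(flow_mono h01 yE) bx.
    by move/eqP: nyb; apply; apply/eqP; rewrite eq_le xb'.
  - move=> /ltW /(flow_mono h01 yE) ax /(flow_mono h01 yE) xb'.
    by rewrite xb' lt_neqAle eq_sym nya ax.
have -> // : (y x \in `]y a, y b]%classic) = (x \in `]a, b]%classic) :> bool.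
by apply/idP/idP; rewrite !inE/= !in_itv/= E.
Qed.

Lemma Rintegral_flow_itv (V : R -> R) a b : measurable_fun setT V ->
  {ae leb R, forall x, h x = 1 -> V x = 0} -> a <= b ->
  \int[leb R]_(x in y @^-1` `]y a, y b]) V x = \int[leb R]_(x in `]a, b]) V x.
Proof.
move=> mV V0 ab; rewrite Rintegral_mkcond [RHS]Rintegral_mkcond.
have E A : V \_ A = (fun x => V x * \1_A x).
  apply/funext => x; rewrite patchE indicE.
  by case: ifP; rewrite ?mulr1 ?mulr0.
rewrite !E; apply: Rintegral_ae_eq.
- apply: measurable_funM => //.
  by apply: (@measurableT_comp _ _ _ _ _ _ (\1_(`]y a, y b]%classic) : R -> R)).
- exact: measurable_funM.
- by apply: ae_imp (flow_itv_ae V0 ab).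
Qed.

(** Since 0 <= 1 - h <= 1, the square is at most w(y)^2 (1 - h), to which the substitution for w^2
    applies. *)
Lemma flow_sq_integrable (w : R -> R) : sq_integrable w ->
  sq_integrable (fun x => w (y x) * (1 - h x)).
Proof.
move=> [mw wi].
have m : measurable_fun setT (fun x => w (y x) * (1 - h x)).
  by apply: measurable_funM => //; exact: measurableT_comp.
split => //.
have [i _] := flow_substitution mh h01 yE yK wi.
apply: integrable_le_norm i => //; first exact: measurable_funX.
move=> x _; rewrite ger0_norm ?sqr_ge0// exprMn ler_wpM2l ?sqr_ge0//.
by have /andP[] := h01 x; nra.
Qed.

(** Both sides have the same integral over every []a, b]]: the right side is handled by substitution
    in [w] times the indicator of []y a, y b]], and the discrepancy between []a, b]] and the
    preimage of []y a, y b]] is invisible to functions that vanish where h = 1. *)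
Lemma flow_density (w W : R -> R) : sq_integrable w -> sq_integrable W ->
  {ae leb R, forall x, h x = 1 -> W x = 0} ->
  (forall a b, a <= b -> \int[leb R]_(x in `]a, b]) W x =
    \int[leb R]_(x in `]y a, y b]) w x) ->
  {ae leb R, forall x, W x = w (y x) * (1 - h x)}.
Proof.
move=> sw sW W0 WK; have sww := flow_sq_integrable sw.
apply: locally_integrable_ae_eq; [exact: sq_integrable_loc..|].
move=> a b /ltW ab; rewrite WK// -[RHS]Rintegral_flow_itv//; last 2 first.
- by case: sww.
- by apply: aeW => x ->; rewrite subrr mulr0.
have iw : (leb R).-integrable setT
    (EFin \o (fun x => w x * \1_(`]y a, y b]%classic) x)).
  apply: sq_integrableM => //; apply: sq_integrable_indic => //.
  exact: finite_measure_segment.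
have [_ E] := flow_substitution mh h01 yE yK iw.
rewrite Rintegral_mkcond [RHS]Rintegral_mkcond.
transitivity (\int[leb R]_x (w x * \1_(`]y a, y b]%classic) x)).
  apply: eq_Rintegral => x _; rewrite patchE indicE.
  by case: ifP; rewrite ?mulr1 ?mulr0.
rewrite -E; apply: eq_Rintegral => x _; rewrite patchE mulrAC indicE.
case: ifPn => [/set_mem xA|/negP xA]; first by rewrite mem_set// mulr1.
by rewrite memNset ?mulr0// => yxA; apply: xA; exact: mem_set.
Qed.

(* Since [1 - h] is the derivative of [y], the assumption gives
   [(1 - h) (1 + w1^2 + w2^2) = 1] along [y] where [h < 1]. *)
Lemma flow_energy (w1 w2 W1 W2 : R -> R) :
  sq_integrable w1 -> sq_integrable w2 -> sq_integrable W1 ->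
  {ae leb R, forall x, W1 x = w1 (y x) * (1 - h x)} ->
  {ae leb R, forall x, W2 x = w2 (y x) * (1 - h x)} ->
  {ae leb R, forall x, (1 - h x) * h x = W1 x ^+ 2 + W2 x ^+ 2} ->
  \int[leb R]_x (w1 x ^+ 2 / (1 + w1 x ^+ 2 + w2 x ^+ 2)) =
  \int[leb R]_x (W1 x ^+ 2).
Proof.
move=> [m1 _] [m2 _] [mW1 _] e1 e2 eh.
pose f x := w1 x ^+ 2 / (1 + w1 x ^+ 2 + w2 x ^+ 2).
have den x : 0 < 1 + w1 x ^+ 2 + w2 x ^+ 2.
  by rewrite ltr_wpDr ?sqr_ge0// ltr_wpDr ?sqr_ge0.
have f0 x : 0 <= f x by rewrite divr_ge0 ?sqr_ge0// ltW.
have mf : measurable_fun setT f.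
  apply: measurable_funM; first exact: measurable_funX.
  have -> : (fun x => (1 + w1 x ^+ 2 + w2 x ^+ 2)^-1) =
      (fun x => (1 + w1 x ^+ 2 + w2 x ^+ 2) `^ (- 1)).
    by apply/funext => x; rewrite powR_inv1// ltW.
  apply: (@measurableT_comp _ _ _ _ _ _ (@powR R ^~ (- 1))) => //.
  apply: measurable_funD; last exact: measurable_funX.
  by apply: measurable_funD => //; exact: measurable_funX.
have mfy : measurable_fun setT (fun x => f (y x) * (1 - h x)).
  by apply: measurable_funM => //; exact: measurableT_comp.
transitivity (\int[leb R]_x (f (y x) * (1 - h x))).
  by rewrite /Rintegral (ge0_flow_substitution mh h01 yE yK).
apply: Rintegral_ae_eq => //; first exact: measurable_funX.
have e12 : {ae leb R, forall x, W1 x = w1 (y x) * (1 - h x) /\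
    W2 x = w2 (y x) * (1 - h x)} by apply: ae_imp2 e1 e2 => x.
apply: ae_imp2 e12 eh => x [-> ->] E; rewrite /f.
(* Where h = 1 both sides vanish. Elsewhere the energy identity can be divided by 1 - h and reads h
   = (1 - h)(w1^2 + w2^2) along [y], so that one factor 1 - h cancels the denominator. *)
have [d0|d0] := eqVneq (1 - h x) 0; first by rewrite d0 !mulr0 expr0n.
have dn := den (y x).
have {E} E : (1 - h x) * (1 + w1 (y x) ^+ 2 + w2 (y x) ^+ 2) = 1.
  apply: (mulfI d0); rewrite mulr1.
  by move: E; rewrite !exprMn; move: (h x) (w1 _) (w2 _) => a b c E; lra.
rewrite exprMn -mulrA; congr (_ * _).
by apply: (mulIf (lt0r_neq0 dn)); rewrite mulrAC mulVf ?lt0r_neq0// expr2 -mulrA E mul1r mulr1.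
Qed.

End flow_density.

(** * The set F_0 *)

Section sup_norm.
Context (R : realType).
Implicit Types (f : R -> R).

(** If f > M somewhere, then f > M on a ball, which has positive measure. *)
Lemma continuous_ae_le f M : continuous f -> {ae leb R, forall x, f x <= M} ->
  forall x, f x <= M.
Proof.
move=> cf [N [mN N0 subN]] x; rewrite leNgt; apply/negP => Mx.
have : \forall z \near x, M < f z by exact: cvgr_gt (cf x) _ Mx.
move=> /nbhs_ballP[r /= r0 rx].
have mb : measurable (ball x r : set (borelR R)) by exact: measurable_ball.
have : (leb R (ball x r) <= leb R N)%E.
  apply: le_measure; rewrite ?inE// => z xz; apply: subN => /= H.
  by have := rx _ xz; rewrite /= ltNge H.
rewrite N0 leNgt => /negP; apply.
by rewrite lebesgue_measure_ball ?ltW// lte_fin mulrn_wgt0.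
Qed.

Lemma norm_LpooE f : norm_Lp +oo f = ess_sup (leb R) (abse \o (EFin \o f)).
Proof.
rewrite /norm_Lp unlock ifT//.
have : (0 < leb R `[0%R, 1%R]%classic)%E.
  by rewrite lebesgue_measure_itv/= lte_fin ltr01 sube0 lte_fin.
by move/lt_le_trans; apply; apply: le_measure; rewrite ?inE.
Qed.

Lemma continuous_norm_Lpoo_le f (M : R) : continuous f ->
  (norm_Lp +oo f <= M%:E)%E -> forall x, `|f x| <= M.
Proof.
move=> cf; rewrite norm_LpooE => /ess_supP H.
apply: continuous_ae_le.
  by move=> x; apply: continuous_comp; [exact: cf|exact: norm_continuous].
by move: H; apply: ae_imp => x; rewrite /= lee_fin.
Qed.

Lemma norm_Lpoo_le f (M : R) : (forall x, `|f x| <= M) ->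
  (norm_Lp +oo f <= M%:E)%E.
Proof.
move=> fM; rewrite norm_LpooE; apply/ess_supP.
by apply: aeW => x /=; rewrite lee_fin.
Qed.

Lemma in_Lpoo_bounded f : continuous f -> in_Lp +oo%E f ->
  exists M, forall x, `|f x| <= M.
Proof.
move=> cf; rewrite /in_Lp inE => /andP[_]; rewrite inE/= /finite_norm => Nf.
exists (fine (norm_Lp +oo f)); apply: continuous_norm_Lpoo_le => //.
rewrite fineK// ge0_fin_numE; first exact: Nf.
exact: Lnorm_ge0.
Qed.

End sup_norm.

Section F0_flow.
Context (R : realType).

(* [h] is a representative of [la_h X] with values in [0, 1]. *)
Definition is_flow (X : lagrangian R) (h : R -> R) (K : R) : Prop :=
  [/\ measurable_fun setT h, forall x, 0 <= h x <= 1,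
      forall a b, a <= b ->
        la_y X b - la_y X a = \int[leb R]_(x in `]a, b]) (1 - h x),
      forall x, `|la_y X x - x| <= K &
      {ae leb R, forall x, h x = la_h X x}] /\
  {ae leb R, forall x,
    (1 - h x) * h x = wderiv (la_U X) x ^+ 2 + la_rbar X x ^+ 2}.

Lemma la_HE (X : lagrangian R) x : in_F0 X -> la_H X x = (- la_zeta X x)%:E.
Proof.
move=> [_ [_ [_ [_ /(_ x)]]]]; rewrite /la_y.
case: (la_H X x) => [r||]//= [E]; congr EFin.
by move: E; move: (la_zeta X x) => z; lra.
Qed.

Lemma la_zeta_itv (X : lagrangian R) a b : in_F0 X -> a <= b ->
  la_zeta X a - la_zeta X b = \int[leb R]_(x in `]a, b]) la_h X x.
Proof.
move=> FX ab; have [[_ _ /in_Lp2P[mh hi] _] [_ [[_ h0 _] _]]] := FX.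
have Hb := la_HE b FX; have Ha := la_HE a FX.
have mhE : measurable_fun [set: borelR R] (EFin \o la_h X).
  by apply/measurable_EFinP; exact: mh.
(* [h] is nonnegative only almost everywhere; its positive part has the same integrals and meets the
   pointwise condition for additivity in the extended reals. *)
pose hp x := Num.max (la_h X x) 0.
have mhp : measurable_fun [set: borelR R] (EFin \o hp).
  by apply/measurable_EFinP; exact: measurable_maxr.
have hpE (A : set (borelR R)) : measurable A ->
    (\int[leb R]_(x in A) (la_h X x)%:E = \int[leb R]_(x in A) (hp x)%:E)%E.
  move=> mA; apply: ae_eq_integral => //.
  - exact: measurable_funTS.
  - exact: measurable_funTS.
  - by move: h0; apply: ae_imp => x h0 _; rewrite /hp max_l.
have hp0 x : (0 <= (hp x)%:E)%E by rewrite lee_fin le_max lexx orbT.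
have : (la_H X b = la_H X a + \int[leb R]_(x in `]a, b]) (la_h X x)%:E)%E.
  rewrite /la_H !hpE// -ge0_integral_setU//=.
  - congr (integral _ _ _); apply/predeqP => x /=; rewrite !in_itv/=; split.
      by move=> xb; have [xa|xa] := leP x a; [left|right].
    by move=> [/le_trans|/andP[]//]; apply.
  - by apply: measurable_funTS.
  - rewrite disj_set2E; apply/eqP/predeqP => x /=; rewrite !in_itv/=; split => //.
    by move=> [xa /andP[ax _]]; move: xa; rewrite leNgt ax.
rewrite Ha Hb /Rintegral => E.
have -> : (\int[leb R]_(x in `]a, b]) (la_h X x)%:E =
    (la_zeta X a - la_zeta X b)%:E)%E.
  move: E; case: (\int[leb R]_(x in `]a, b]) (la_h X x)%:E)%E => [r||]//= [E].
  by congr EFin; rewrite E; ring.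
by [].
Qed.

(** The increments of zeta are minus the integrals of [h], so zeta_xi = - h and y_xi = 1 - h almost
    everywhere; then y_xi >= 0 and h >= 0 confine [h] to [0, 1]. A bound for |zeta| serves as
    [K]. *)
Lemma in_F0_is_flow (X : lagrangian R) : in_F0 X -> exists h K, is_flow X h K.
Proof.
move=> FX; have [[[cz zoo wz wz2] [cU _ _ _] /in_Lp2P sh _] [_ [[y0 h0 _] [yh _]]]] := FX.
have [K zK] := in_Lpoo_bounded cz zoo.
have dz := wderivP wz.
have lz : locally_integrable setT (wderiv (la_zeta X)) by case: dz.
have wzE : {ae leb R, forall x, wderiv (la_zeta X) x = - la_h X x}.
  apply: locally_integrable_ae_eq => //.
    by apply: locally_integrableN; exact: sq_integrable_loc.
  move=> a b /ltW ab; rewrite -(wderiv_itv wz)//.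
  under eq_Rintegral do rewrite -mulN1r.
  rewrite RintegralZl//; last first.
    exact: locally_integrable_itv (sq_integrable_loc sh).
  by rewrite -la_zeta_itv// mulN1r opprB.
have wyE : {ae leb R, forall x, wderiv (la_y X) x = 1 - la_h X x}.
  have d := is_weak_derivative_linear 1 dz (is_weak_derivative_id R).
  have yE : la_y X = (fun x => la_zeta X x + 1 * x).
    by apply/funext => x; rewrite mul1r.
  have wy : weakly_differentiable (la_y X) by rewrite yE; eexists; exact: d.
  have cy : continuous (la_y X).
    by move=> x; apply: cvgD; [exact: cz|exact: cvg_id].
  have d' : is_weak_derivative (la_y X) (fun x => wderiv (la_zeta X) x + 1 * cst 1 x).
    by rewrite yE.
  have := weak_derivative_unique cy (wderivP wy) d'.
  by apply: ae_imp2 wzE => x -> ->; rewrite /= mulr1 addrC.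
(* Clamping changes [la_h X] only on a null set and makes the bounds hold at every point. *)
pose h x := Num.min (Num.max (la_h X x) 0) 1.
have h_ae : {ae leb R, forall x, h x = la_h X x}.
  have h1 : {ae leb R, forall x, la_h X x <= 1}.
    by apply: ae_imp2 wyE y0 => x ->; rewrite subr_ge0.
  by apply: ae_imp2 h0 h1 => x x0 x1; rewrite /h max_l// min_l.
exists h, K; split; first split.
- by apply: measurable_minr => //; apply: measurable_maxr => //; case: sh.
- by move=> x; rewrite /h le_min ge_min lexx ler01 le_max lexx !orbT.
- move=> a b ab.
  have mh : measurable_fun setT h.
    by apply: measurable_minr => //; apply: measurable_maxr => //; case: sh.
  have hi : (leb R).-integrable `]a, b] (EFin \o la_h X).
    exact: locally_integrable_itv (sq_integrable_loc sh).
  transitivity (\int[leb R]_(x in `]a, b]) (1 - la_h X x)).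
    rewrite RintegralB//; last first.
      apply: (@measurable_bounded_integrable _ _ _ _ (cst 1)) => //.
        exact: finite_measure_segment.
      exact: bounded_cst.
    rewrite Rintegral_cst_itv// -la_zeta_itv// /la_y mul1r.
    by move: (la_zeta X a) (la_zeta X b) => za zb; lra.
  rewrite Rintegral_mkcond [RHS]Rintegral_mkcond; apply: Rintegral_ae_eq.
  + apply/(measurable_restrictT _ _).1 => //; apply: measurable_funTS.
    by apply: measurable_funB => //; case: sh.
  + apply/(measurable_restrictT _ _).1 => //; apply: measurable_funTS.
    by apply: measurable_funB.
  + by move: h_ae; apply: ae_imp => x xh; rewrite !patchE xh.
- by move=> x; rewrite /la_y addrK.
- exact: h_ae.
- have hy : {ae leb R, forall x, h x = la_h X x /\ wderiv (la_y X) x = 1 - la_h X x}.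
    by apply: ae_imp2 h_ae wyE => x.
  by apply: ae_imp2 hy yh => x [-> ->].
Qed.

End F0_flow.

(** * Strong convergence in L^2 *)

Section L2_convergence.
Context (R : realType).
Implicit Types (f g w : R -> R).

Definition L2_cvg (f_ : nat -> R -> R) f : Prop :=
  (forall n, sq_integrable (f_ n)) /\ sq_integrable f /\
  \int[leb R]_x ((f_ n x - f x) ^+ 2) @[n --> \oo] --> (0 : R).

Lemma Rintegral_sqr_ge0 f : 0 <= \int[leb R]_x (f x ^+ 2).
Proof. by apply: Rintegral_ge0 => x _; exact: sqr_ge0. Qed.

(** Both integrals are written as differences of integrals from the common left end min(p, a). Each
    end point then costs one [Rintegral_itv_le_AMGM] on the interval between its two positions,
    whence the factor 2. *)
Lemma Rintegral_itv_dist w p q a b (d : R) : sq_integrable w -> 0 < d ->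
  p <= q -> a <= b ->
  `|\int[leb R]_(x in `]p, q]) w x - \int[leb R]_(x in `]a, b]) w x| <=
    2 * d * \int[leb R]_x (w x ^+ 2) + d^-1 * (`|p - a| + `|q - b|).
Proof.
move=> sw d0 pq ab; pose m := Num.min p a.
have lw := sq_integrable_loc sw.
have mp : m <= p by rewrite ge_min lexx.
have ma : m <= a by rewrite ge_min lexx orbT.
have key x z : m <= x -> m <= z ->
    `|\int[leb R]_(t in `]m, x]) w t - \int[leb R]_(t in `]m, z]) w t| <=
    d * \int[leb R]_x (w x ^+ 2) + d^-1 * `|x - z|.
  wlog xz : x z / x <= z.
    move=> H mx mz; have [xz|/ltW zx] := leP x z; first exact: H.
    by rewrite distrC (distrC x); exact: H.
  move=> mx mz; rewrite (Rintegral_itv_cat lw mx xz) opprD addrA subrr sub0r.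
  rewrite normrN (distrC x) (ger0_norm (_ : 0 <= z - x)) ?subr_ge0//.
  exact: Rintegral_itv_le_AMGM.
have Epq := Rintegral_itv_cat lw mp pq.
have Eab := Rintegral_itv_cat lw ma ab.
have := key _ _ (le_trans mp pq) (le_trans ma ab).
have := key _ _ mp ma.
rewrite !ler_norml => /andP[h1 h2] /andP[h3 h4].
by rewrite mulrDr; apply/andP; split; lra.
Qed.

Lemma L2_cvg_near (f_ : nat -> R -> R) f : L2_cvg f_ f -> forall e : R, 0 < e ->
  \forall n \near \oo, \int[leb R]_x ((f_ n x - f x) ^+ 2) <= e.
Proof.
move=> [_ [_ /cvgrPdist_le H]] e e0; near=> n.
have : `|0 - \int[leb R]_x ((f_ n x - f x) ^+ 2)| <= e by near: n; exact: H.
by rewrite sub0r normrN ger0_norm// Rintegral_sqr_ge0.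
Unshelve. all: by end_near. Qed.

Lemma L2_cvg_itv (f_ : nat -> R -> R) f a b : L2_cvg f_ f -> a <= b ->
  \int[leb R]_(x in `]a, b]) f_ n x @[n --> \oo] -->
  \int[leb R]_(x in `]a, b]) f x.
Proof.
move=> ff ab; have [sf_ [sf _]] := ff.
(* This large weight makes the length term at most e / 2; the energy of f_n - f is then required to
   be at most e / (2 d). *)
apply/cvgrPdist_le => e e0; pose d := 2 * (b - a + 1) / e.
have d0 : 0 < d by rewrite divr_gt0// mulr_gt0// ltr_wpDl// subr_ge0.
have ed : 0 < e / (2 * d) by rewrite divr_gt0// mulr_gt0.
near=> n; rewrite distrC -RintegralB//; last 2 first.
- exact: locally_integrable_itv (sq_integrable_loc (sf_ n)).
- exact: locally_integrable_itv (sq_integrable_loc sf).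
have H : \int[leb R]_x ((f_ n x - f x) ^+ 2) <= e / (2 * d).
  by near: n; exact: L2_cvg_near.
have s := sq_integrableB (sf_ n) sf.
rewrite (le_trans (Rintegral_itv_le_AMGM d0 s ab))//.
have H1 : d * \int[leb R]_x ((f_ n x - f x) ^+ 2) <= e / 2.
  rewrite (le_trans (ler_wpM2l (ltW d0) H))//.
  have -> // : d * (e / (2 * d)) = e / 2.
  by field; rewrite gt_eqF.
have H2 : d^-1 * (b - a) <= e / 2.
  have b1 : 0 < b - a + 1 by rewrite ltr_wpDl// subr_ge0.
  have -> : d^-1 * (b - a) = e / 2 * ((b - a) / (b - a + 1)).
    by rewrite /d; field; rewrite !gt_eqF.
  by rewrite ler_piMr ?divr_ge0 ?(ltW e0)// ler_pdivrMr// mul1r lerDl.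
lra.
Unshelve. all: by end_near. Qed.

(** f_n^2 - f^2 = (f_n - f)^2 + 2 f (f_n - f), and Young's inequality with a small weight on f^2
    bounds the cross term. *)
Lemma L2_cvg_sqr (f_ : nat -> R -> R) f : L2_cvg f_ f ->
  \int[leb R]_x (f_ n x ^+ 2) @[n --> \oo] --> \int[leb R]_x (f x ^+ 2).
Proof.
move=> ff; have [sf_ [sf _]] := ff.
apply/cvgrPdist_le => e e0; set C := \int[leb R]_x (f x ^+ 2).
have C0 : 0 <= C by exact: Rintegral_sqr_ge0.
pose d := e / (4 * (C + 1)).
have C1 : 0 < C + 1 by rewrite ltr_wpDl.
have d0 : 0 < d by rewrite divr_gt0// mulr_gt0.
have dC : d * C <= e / 4.
  have -> : d * C = e / 4 * (C / (C + 1)) by rewrite /d; field; rewrite gt_eqF.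
  by rewrite ler_piMr ?divr_ge0 ?(ltW e0)// ler_pdivrMr ?mul1r ?lerDl.
have e40 : 0 < e / 8 by rewrite divr_gt0.
have e80 : 0 < e / 8 * d by rewrite mulr_gt0.
near=> n; rewrite distrC /C.
have H1 : \int[leb R]_x ((f_ n x - f x) ^+ 2) <= e / 8.
  by near: n; exact: L2_cvg_near.
have H2 : \int[leb R]_x ((f_ n x - f x) ^+ 2) <= e / 8 * d.
  by near: n; exact: L2_cvg_near.
have s := sq_integrableB (sf_ n) sf.
have E : \int[leb R]_x (f_ n x ^+ 2) - \int[leb R]_x (f x ^+ 2) =
    \int[leb R]_x ((f_ n x - f x) ^+ 2) + 2 * \int[leb R]_x (f x * (f_ n x - f x)).
  have i1 := sq_integrableM sf s.
  have [_ i2] := sf_ n; have [_ i3] := sf; have [_ i4] := s.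
  rewrite -RintegralZl// -RintegralB// -RintegralD//; last exact: integrable_scaler.
  by apply: eq_Rintegral => x _; ring.
have A := Rintegral_AMGM d0 sf s.
have B : d^-1 * \int[leb R]_x ((f_ n x - f x) ^+ 2) <= e / 8.
  by rewrite mulrC ler_pdivrMr.
have := Rintegral_sqr_ge0 (fun x => f_ n x - f x).
move: A; rewrite E -/C !ler_norml => /andP[A1 A2] ge0.
by apply/andP; split; lra.
Unshelve. all: by end_near. Qed.

Lemma integrable_sqr_indic f (A : set R) : sq_integrable f -> measurable A ->
  (leb R).-integrable setT (EFin \o (fun x => f x ^+ 2 * \1_A x)).
Proof.
move=> [mf fi] mA; apply: integrable_le_norm fi => //.
  by apply: measurable_funM; [exact: measurable_funX|exact: measurable_indic].
move=> x _; rewrite indicE; case: (_ \in _).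
  by rewrite mulr1 ger0_norm ?sqr_ge0.
by rewrite mulr0 normr0 sqr_ge0.
Qed.

Lemma L2_tail_cvg f : sq_integrable f ->
  \int[leb R]_x (f x ^+ 2 * \1_(~` `]- n%:R, n%:R]%classic) x) @[n --> \oo]
    --> (0 : R).
Proof.
move=> [mf fi].
have -> : (0 : R) = \int[leb R]_x 0 by rewrite Rintegral_cst// mul0r.
apply: (@Rintegral_dominated_cvg _ _ _ (fun x => f x ^+ 2)) => //.
- move=> n; apply: measurable_funM; first exact: measurable_funX.
  by apply: measurable_indic; apply: measurableC.
- move=> x; apply: cvg_near_cst; near=> n.
  have xn : `|x| < n%:R by near: n; exact: nbhs_infty_gtr.
  rewrite indicE memNset ?mulr0//=; apply; rewrite in_itv/=.
  by move: xn; rewrite ltr_norml => /andP[-> /ltW].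
- move=> n x; rewrite indicE; case: (_ \in _).
    by rewrite mulr1 ger0_norm ?sqr_ge0.
  by rewrite mulr0 normr0 sqr_ge0.
Unshelve. all: by end_near. Qed.

(** A Sobolev bound with a crude constant. With weight 1 / e, [f] moves by at most 2 e from [f x] on
    []x, x + 1]]; were |f x| > 4 e, |f| would be at least 2 e there and f^2 would have integral at
    least 4 e^2. *)
Lemma H1_sup_le f (e : R) : continuous f -> weakly_differentiable f ->
  sq_integrable f -> sq_integrable (wderiv f) -> 0 < e ->
  \int[leb R]_x (f x ^+ 2) <= e ^+ 2 ->
  \int[leb R]_x (wderiv f x ^+ 2) <= e ^+ 2 -> forall x, `|f x| <= 4 * e.
Proof.
move=> cf wf sf sf' e0 fe f'e x; rewrite leNgt; apply/negP => fx.
have f2 z : x < z <= x + 1 -> 4 * e ^+ 2 <= f z ^+ 2.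
  move=> /andP[/ltW xz zx1].
  have ei : 0 < e^-1 by rewrite invr_gt0.
  have := Rintegral_itv_le_AMGM ei sf' xz; rewrite -wderiv_itv// invrK => H.
  have H1 : e^-1 * \int[leb R]_x (wderiv f x ^+ 2) <= e.
    rewrite (le_trans (ler_wpM2l (ltW ei) f'e))// expr2 mulrA mulVf ?gt_eqF//.
    by rewrite mul1r.
  have H2 : e * (z - x) <= e by rewrite ler_piMr ?(ltW e0)//; lra.
  have H3 : 2 * e <= `|f z|.
    have := lerB_dist (f x) (f z); rewrite distrC => H4.
    have := le_trans H4 H; lra.
  have -> : 4 * e ^+ 2 = (2 * e) ^+ 2 by rewrite exprMn; congr (_ * _); ring.
  by rewrite -[leRHS](real_normK (num_real (f z))) lerXn2r ?nnegrE// mulr_ge0// ltW.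
have xx1 : x <= x + 1 by rewrite lerDl.
have : 4 * e ^+ 2 <= \int[leb R]_x (f x ^+ 2).
  have -> : 4 * e ^+ 2 = \int[leb R]_(z in `]x, x + 1]) (4 * e ^+ 2).
    by rewrite Rintegral_cst_itv// addrAC subrr add0r mulr1.
  have [_ fi] := sf.
  have i1 : (leb R).-integrable `]x, x + 1] (EFin \o cst (4 * e ^+ 2)).
    apply: measurable_bounded_integrable => //.
      exact: finite_measure_segment.
    exact: bounded_cst.
  have i2 : (leb R).-integrable `]x, x + 1] (EFin \o (fun z => f z ^+ 2)).
    exact: integrableS fi.
  have i3 : (leb R).-integrable setT
      (EFin \o ((fun z => f z ^+ 2) \_ `]x, x + 1])).
    by rewrite -restrict_EFin; apply/integrable_restrict => //=; rewrite setTI.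
  have : \int[leb R]_(z in `]x, x + 1]) (4 * e ^+ 2) <=
      \int[leb R]_(z in `]x, x + 1]) (f z ^+ 2).
    exact: (@le_Rintegral _ _ _ (leb R) _ (cst (4 * e ^+ 2))).
  move/le_trans; apply; rewrite Rintegral_mkcond.
  apply: (le_Rintegral _ i3 fi) => // z _.
  by rewrite patchE; case: ifP => // _; exact: sqr_ge0.
have : 0 < e ^+ 2 by rewrite exprn_gt0.
lra.
Qed.

End L2_convergence.

(** * The map M *)

Section pushforward.
Context (R : realType) (X : lagrangian R) (Y : eulerian R) (h : R -> R) (K : R).
Hypothesis FX : in_F0 X.
Hypothesis flX : is_flow X h K.
Hypothesis DY : in_D Y.
Hypothesis MXY : is_M X Y.

Let y := la_y X.

Lemma is_flow_fibre0 : {ae leb R, forall x, h x = 1 ->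
  wderiv (la_U X) x = 0 /\ la_rbar X x = 0}.
Proof.
have [_] := flX; apply: ae_imp => x E h1.
move: E; rewrite h1 subrr mul0r => /esym/eqP.
rewrite paddr_eq0 ?sqr_ge0// !sqrf_eq0 => /andP[/eqP -> /eqP ->].
by [].
Qed.

(** Both sides equal U b - U a, because u(y) = U. *)
Lemma is_M_wderiv_itv a b : a <= b ->
  \int[leb R]_(x in `]a, b]) wderiv (la_U X) x =
  \int[leb R]_(x in `]y a, y b]) wderiv (eu_u Y) x.
Proof.
move=> ab; have [[_ h01 yE _ _] _] := flX.
have [[_ [cU _ wU _] _ _] _] := FX; have [[cu _ wu _] _ _] := DY.
have [uU _ _ _] := MXY.
by rewrite -!wderiv_itv// ?(flow_mono h01 yE ab)// !uU.
Qed.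

(** The pushforward identity on the bounded set []y a, y b]], whose preimage may be replaced by []a,
    b]] because [rbar] vanishes a.e. where h = 1. *)
Lemma is_M_rhobar_itv a b : a <= b ->
  \int[leb R]_(x in `]a, b]) la_rbar X x =
  \int[leb R]_(x in `]y a, y b]) eu_rhobar Y x.
Proof.
move=> ab; have [[mh h01 yE yK _] _] := flX.
have [[_ _ _ /in_Lp2P[mr _]] _] := FX; have [_ _ rr _] := MXY.
rewrite rr//; last first.
  have [M [Mr MP]] := compact_bounded (@segment_compact _ (y a) (y b)).
  exists M; split => // N /MP MN x /=; rewrite in_itv/= => /andP[/ltW ax xb].
  by apply: MN; rewrite /= in_itv/= ax.
apply/esym/(Rintegral_flow_itv mh h01 yE yK) => //.
by have := is_flow_fibre0; apply: ae_imp => x /[apply] -[].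
Qed.

Lemma is_M_sq_integrable : [/\ sq_integrable (wderiv (eu_u Y)),
  sq_integrable (eu_rhobar Y), sq_integrable (wderiv (la_U X)) &
  sq_integrable (la_rbar X)].
Proof.
have [[_ [_ _ _ /in_Lp2P sU] _ /in_Lp2P sr] _] := FX.
by have [[_ _ _ /in_Lp2P su] /in_Lp2P sR _] := DY; split.
Qed.

Lemma is_M_wderiv_ae :
  {ae leb R, forall x, wderiv (la_U X) x = wderiv (eu_u Y) (y x) * (1 - h x)}.
Proof.
have [[mh h01 yE yK _] _] := flX; have [su _ sU _] := is_M_sq_integrable.
apply: (flow_density mh h01 yE yK su sU _ is_M_wderiv_itv).
by have := is_flow_fibre0; apply: ae_imp => x /[apply] -[].
Qed.

Lemma is_M_rhobar_ae :
  {ae leb R, forall x, la_rbar X x = eu_rhobar Y (y x) * (1 - h x)}.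
Proof.
have [[mh h01 yE yK _] _] := flX; have [_ sR _ sr] := is_M_sq_integrable.
apply: (flow_density mh h01 yE yK sR sr _ is_M_rhobar_itv).
by have := is_flow_fibre0; apply: ae_imp => x /[apply] -[].
Qed.

Lemma energy_ratio_wderiv : energy_ratio (wderiv (eu_u Y)) Y =
  \int[leb R]_x (wderiv (la_U X) x ^+ 2).
Proof.
have [[mh h01 yE yK _] e] := flX; have [su sR sU sr] := is_M_sq_integrable.
exact: (flow_energy mh h01 yE yK su sR sU is_M_wderiv_ae is_M_rhobar_ae e).
Qed.

Lemma energy_ratio_rhobar : energy_ratio (eu_rhobar Y) Y =
  \int[leb R]_x (la_rbar X x ^+ 2).
Proof.
have [[mh h01 yE yK _] e] := flX; have [su sR sU sr] := is_M_sq_integrable.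
rewrite -(flow_energy mh h01 yE yK sR su sr is_M_rhobar_ae is_M_wderiv_ae).
  by apply: eq_Rintegral => x _; rewrite addrAC.
by move: e; apply: ae_imp => x ->; rewrite addrC.
Qed.

Lemma in_D_energy_le :
  \int[leb R]_x (wderiv (eu_u Y) x ^+ 2) <= fine (eu_mu Y setT) /\
  \int[leb R]_x (eu_rhobar Y x ^+ 2) <= fine (eu_mu Y setT).
Proof.
have [_ _ [nu [_ /(_ _ measurableT) E]]] := DY.
have [[mu ui] [mr ri] _ _] := is_M_sq_integrable.
have : (\int[leb R]_x (wderiv (eu_u Y) x ^+ 2 + eu_rhobar Y x ^+ 2)%:E <=
    eu_mu Y setT)%E by rewrite E leeDl.
rewrite -[in X in (_ <= X)%E](@fineK _ (eu_mu Y setT)); last exact: fin_num_measure.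
have i : (leb R).-integrable setT
    (EFin \o (fun x => wderiv (eu_u Y) x ^+ 2 + eu_rhobar Y x ^+ 2)).
  exact: integrable_addr.
rewrite -(@fineK _ (\int[leb R]_x _)%E) ?integrable_fin_num// lee_fin => H.
by split; apply: le_trans H; apply: le_Rintegral => // x _;
  rewrite ?lerDl ?lerDr sqr_ge0.
Qed.

(** The preimage of []-oo, x]] is []-oo, s]], so the left side is H(s) = s - y(s). *)
Lemma dist_fun_fibre x s : y s = x -> (forall t, (y t <= x) = (t <= s)) ->
  dist_fun (eu_mu Y) x = s - x.
Proof.
move=> ys sP; have [_ muE _ _] := MXY.
transitivity (fine
    (\int[leb R]_(t in la_y X @^-1` `]-oo, x]%classic) (la_h X t)%:E)%E).
  by congr fine; exact: muE.
have -> : la_y X @^-1` `]-oo, x]%classic = `]-oo, s]%classic.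
  by apply/predeqP => t /=; rewrite !in_itv/= -sP.
rewrite -/(la_H X s) la_HE//= -ys /y /la_y.
by rewrite opprD addrCA subrr addr0.
Qed.

End pushforward.

(** Let [s1] and [s2] be the right ends of the fibres over x and x + e. Closeness of the flows gives
    y2(s1) <= x + e, that is s1 <= s2, and the two distribution functions are s1 - x and s2 - x -
    e. *)
Lemma dist_fun_le (R : realType) (X1 X2 : lagrangian R) (Y1 Y2 : eulerian R)
    h1 h2 K1 K2 (e : R) : in_F0 X1 -> in_F0 X2 ->
  is_flow X1 h1 K1 -> is_flow X2 h2 K2 -> is_M X1 Y1 -> is_M X2 Y2 ->
  (forall x, `|la_zeta X1 x - la_zeta X2 x| <= e) ->
  forall x, dist_fun (eu_mu Y1) x <= dist_fun (eu_mu Y2) (x + e) + e.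
Proof.
move=> F1 F2 [[mh1 h11 yE1 yK1 _] _] [[mh2 h21 yE2 yK2 _] _] M1 M2 ze x.
have [s1 [ys1 P1]] := flow_fibre mh1 h11 yE1 yK1 x.
have [s2 [ys2 P2]] := flow_fibre mh2 h21 yE2 yK2 (x + e).
rewrite (dist_fun_fibre F1 M1 ys1 P1) (dist_fun_fibre F2 M2 ys2 P2).
suff : s1 <= s2 by lra.
rewrite -P2 -ys1 /la_y; have := ze s1; rewrite ler_norml => /andP[? ?].
by lra.
Qed.

Lemma dist_fun_cvg_setT (R : realType) (Y : eulerian R) :
  dist_fun (eu_mu Y) n%:R @[n --> \oo] --> fine (eu_mu Y setT).
Proof.
apply: fine_cvg; rewrite fineK; last exact: fin_num_measure.
have -> : [set: borelR R] = \bigcup_n `]-oo, n%:R]%classic.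
  apply/esym/predeqP => x; split => // _.
  exists (Num.truncn `|x|).+1 => //=; rewrite in_itv/=.
  by rewrite (le_trans (ler_norm _))// ltW// truncnS_gt.
apply: nondecreasing_cvg_mu.
- by [].
- by apply: bigcup_measurable.
- by move=> m n mn; apply/subsetPset; apply: subset_itvl; rewrite bnd_simp ler_nat.
Qed.

Lemma dist_fun_le_setT (R : realType) (Y : eulerian R) x :
  dist_fun (eu_mu Y) x <= fine (eu_mu Y setT).
Proof.
apply: fine_le; [exact: fin_num_measure..|].
by apply: le_measure; rewrite ?inE.
Qed.

(** * Convergence in Eulerian coordinates *)

Section convergence.
Context (R : realType).

Definition components_le (X : lagrangian R) (e : R) : Prop :=
  [/\ (norm_Lp +oo (la_zeta X) <= e%:E)%E, (norm_H1 (la_U X) <= e%:E)%E,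
      (norm_Lp 2%:E (la_rbar X) <= e%:E)%E & `|la_k X| <= e].

Lemma cvg_E_near (X_ : nat -> lagrangian R) (X : lagrangian R) (e : R) :
  cvg_E X_ X -> 0 < e ->
  \forall n \near \oo, components_le (la_sub (X_ n) X) e.
Proof.
move=> /fine_cvgP[Hfin /cvgrPdist_le H] e0; near=> n.
have : (norm_E (la_sub (X_ n) X) <= e%:E)%E.
  rewrite -(@fineK _ (norm_E _)) ?lee_fin; last by near: n.
  have : `|0 - fine (norm_E (la_sub (X_ n) X))| <= e by near: n; exact: H.
  by rewrite sub0r normrN; apply: le_trans; exact: ler_norm.
rewrite /norm_E /norm_V /=.
set A := norm_Lp +oo _; set B := norm_Lp 2%:E (wderiv _).
set C := norm_H1 _; set D := norm_Lp 2%:E _; set F := norm_Lp 2%:E _.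
have [A0 B0] : (0 <= A)%E /\ (0 <= B)%E by split; exact: Lnorm_ge0.
have [D0 F0] : (0 <= D)%E /\ (0 <= F)%E by split; exact: Lnorm_ge0.
have C0 : (0 <= C)%E by exact: poweR_ge0.
have k0 : (0 <= `|la_k (X_ n) - la_k X|%:E)%E by rewrite lee_fin.
move=> S; split.
- apply: le_trans S; do 3 apply: le_trans (leeDl _ _) => //.
  by apply: le_trans (leeDl _ _) => //; rewrite leeDl.
- apply: le_trans S; do 2 apply: le_trans (leeDl _ _) => //.
  by apply: le_trans (leeDl _ _) => //; rewrite leeDr// adde_ge0.
- apply: le_trans S; apply: le_trans (leeDl _ _) => //.
  by rewrite leeDr// !adde_ge0.
- by rewrite -lee_fin; apply: le_trans S; rewrite leeDr// !adde_ge0.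
Unshelve. all: by end_near. Qed.

Lemma norm_Lp2_le (f : R -> R) (e : R) : sq_integrable f ->
  (norm_Lp 2%:E f <= e%:E)%E -> \int[leb R]_x (f x ^+ 2) <= e ^+ 2.
Proof.
move=> [mf fi] fe; have N0 : (0 <= norm_Lp 2%:E f)%E by exact: Lnorm_ge0.
have e0 : 0 <= e by rewrite -lee_fin (le_trans N0).
rewrite -lee_fin /Rintegral fineK ?integrable_fin_num//.
rewrite -norm_Lp2_sqr -(powR_mulrn 2 e0) -poweR_EFin.
by apply: gt0_ler_poweR => //; rewrite in_itv/= ?N0 ?lee_fin ?e0 leey.
Qed.

Lemma norm_H1_le (f : R -> R) (e : R) : sq_integrable f ->
  sq_integrable (wderiv f) -> (norm_H1 f <= e%:E)%E ->
  \int[leb R]_x (f x ^+ 2) <= e ^+ 2 /\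
  \int[leb R]_x (wderiv f x ^+ 2) <= e ^+ 2.
Proof.
move=> [mf fi] [mf' f'i] fe.
have N0 : (0 <= norm_H1 f)%E by exact: poweR_ge0.
have e0 : 0 <= e by rewrite -lee_fin (le_trans N0).
have A0 : (0 <= \int[leb R]_x (f x ^+ 2)%:E)%E.
  by apply: integral_ge0 => x _; rewrite lee_fin sqr_ge0.
have B0 : (0 <= \int[leb R]_x (wderiv f x ^+ 2)%:E)%E.
  by apply: integral_ge0 => x _; rewrite lee_fin sqr_ge0.
have : (norm_H1 f `^ 2 <= (e ^+ 2)%:E)%E.
  rewrite -(powR_mulrn 2 e0) -poweR_EFin.
  by apply: gt0_ler_poweR => //; rewrite in_itv/= ?N0 ?lee_fin ?e0 leey.
rewrite /norm_H1 -poweRrM mulVf// poweRe1 ?adde_ge0 ?poweR_ge0// !norm_Lp2_sqr => S.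
split; rewrite -lee_fin /Rintegral fineK ?integrable_fin_num//.
  by apply: le_trans S; rewrite leeDl.
by apply: le_trans S; rewrite leeDr.
Qed.

Lemma L2_cvgP (f_ : nat -> R -> R) (f : R -> R) :
  (forall n, sq_integrable (f_ n)) -> sq_integrable f ->
  (forall e : R, 0 < e -> \forall n \near \oo,
    \int[leb R]_x ((f_ n x - f x) ^+ 2) <= e ^+ 2) -> L2_cvg f_ f.
Proof.
move=> sf_ sf H; split => //; split => //.
(* With e <= 1 one has e^2 <= e <= d. *)
apply/cvgrPdist_le => d d0; pose e := Num.min d 1.
have e0 : 0 < e by rewrite lt_min d0 ltr01.
near=> n; rewrite sub0r normrN ger0_norm ?Rintegral_sqr_ge0//.
have : \int[leb R]_x ((f_ n x - f x) ^+ 2) <= e ^+ 2 by near: n; exact: H.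
move/le_trans; apply; rewrite expr2.
have ed : e <= d by rewrite ge_min lexx.
have e1 : e <= 1 by rewrite ge_min lexx orbT.
by rewrite (le_trans _ ed)// ler_piMr// ltW.
Unshelve. all: by end_near. Qed.

(** The norm of [la_sub] involves [wderiv] of a difference, which agrees with the difference of the
    derivatives only almost everywhere; the integrals of the squares coincide all the same. Uniform
    closeness of U_n then follows from [H1_sup_le]. *)
Lemma cvg_E_L2 (X_ : nat -> lagrangian R) (X : lagrangian R) :
  (forall n, in_F0 (X_ n)) -> in_F0 X -> cvg_E X_ X ->
  [/\ L2_cvg (fun n => la_U (X_ n)) (la_U X),
      L2_cvg (fun n => wderiv (la_U (X_ n))) (wderiv (la_U X)),
      L2_cvg (fun n => la_rbar (X_ n)) (la_rbar X) &
      forall e : R, 0 < e -> \forall n \near \oo,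
        forall x, `|la_U (X_ n) x - la_U X x| <= e].
Proof.
move=> FX_ FX XX.
have [[_ [cU /in_Lp2P sU wU /in_Lp2P sU'] _ /in_Lp2P sr] _] := FX.
have cU_ n : continuous (la_U (X_ n)) by have [[_ []]] := FX_ n.
have wU_ n : weakly_differentiable (la_U (X_ n)) by have [[_ []]] := FX_ n.
have sU_ n : sq_integrable (la_U (X_ n)) by have [[_ [_ /in_Lp2P]]] := FX_ n.
have sU'_ n : sq_integrable (wderiv (la_U (X_ n))).
  by have [[_ [_ _ _ /in_Lp2P]]] := FX_ n.
have sr_ n : sq_integrable (la_rbar (X_ n)) by have [[_ _ _ /in_Lp2P]] := FX_ n.
have dE n : la_U (X_ n) \- la_U X = (fun x => la_U (X_ n) x + (-1) * la_U X x).
  by apply/funext => x; rewrite mulN1r.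
have cD n : continuous (la_U (X_ n) \- la_U X).
  by move=> x; apply: cvgB; [exact: cU_|exact: cU].
have wD n : weakly_differentiable (la_U (X_ n) \- la_U X).
  rewrite dE; eexists; apply: is_weak_derivative_linear.
    exact: wderivP (wU_ n).
  exact: wderivP wU.
have aeD n : {ae leb R, forall x, wderiv (la_U (X_ n) \- la_U X) x =
    wderiv (la_U (X_ n)) x - wderiv (la_U X) x}.
  rewrite dE; have := wderiv_linear (-1) (cU_ n) cU (wU_ n) wU.
  by apply: ae_imp => x; rewrite mulN1r.
have sD n : sq_integrable (la_U (X_ n) \- la_U X).
  exact: sq_integrableB.
have mD n : measurable_fun setT (wderiv (la_U (X_ n) \- la_U X)).
  by have [_ [] ] := wderivP (wD n).
have sD2 n : sq_integrable (fun x => wderiv (la_U (X_ n)) x - wderiv (la_U X) x).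
  exact: sq_integrableB.
have intD n : (\int[leb R]_x (wderiv (la_U (X_ n) \- la_U X) x ^+ 2)%:E =
    \int[leb R]_x ((wderiv (la_U (X_ n)) x - wderiv (la_U X) x) ^+ 2)%:E)%E.
  apply: ae_eq_integral => //.
  - by apply/measurable_EFinP; apply: measurable_funX; exact: mD.
  - by apply/measurable_EFinP; apply: measurable_funX; have [] := sD2 n.
  - by have := aeD n; apply: ae_imp => x -> _.
have sD' n : sq_integrable (wderiv (la_U (X_ n) \- la_U X)).
  split; first exact: mD.
  apply/(integrable_sqrP (mD n)); rewrite intD.
  by have [m i] := sD2 n; exact/(integrable_sqrP m).
have H1 (e : R) : 0 < e -> \forall n \near \oo,
    \int[leb R]_x ((la_U (X_ n) x - la_U X x) ^+ 2) <= e ^+ 2 /\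
    \int[leb R]_x (wderiv (la_U (X_ n) \- la_U X) x ^+ 2) <= e ^+ 2.
  move=> e0; near=> n.
  have [_ h1 _ _] : components_le (la_sub (X_ n) X) e by near: n; exact: cvg_E_near.
  exact: (norm_H1_le (sD n) (sD' n) h1).
split.
- apply: L2_cvgP => // e e0; near=> n.
  by have [] : \int[leb R]_x ((la_U (X_ n) x - la_U X x) ^+ 2) <= e ^+ 2 /\
    \int[leb R]_x (wderiv (la_U (X_ n) \- la_U X) x ^+ 2) <= e ^+ 2
    by near: n; exact: H1.
- apply: L2_cvgP => // e e0; near=> n.
  rewrite /Rintegral -intD.
  by have [] : \int[leb R]_x ((la_U (X_ n) x - la_U X x) ^+ 2) <= e ^+ 2 /\
    \int[leb R]_x (wderiv (la_U (X_ n) \- la_U X) x ^+ 2) <= e ^+ 2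
    by near: n; exact: H1.
- apply: L2_cvgP => // e e0; near=> n.
  have [_ _ h1 _] : components_le (la_sub (X_ n) X) e by near: n; exact: cvg_E_near.
  by apply: norm_Lp2_le => //; exact: sq_integrableB.
- move=> e e0; have e4 : 0 < e / 4 by rewrite divr_gt0.
  near=> n => x.
  have [h1 h2] : \int[leb R]_x ((la_U (X_ n) x - la_U X x) ^+ 2) <= (e / 4) ^+ 2 /\
    \int[leb R]_x (wderiv (la_U (X_ n) \- la_U X) x ^+ 2) <= (e / 4) ^+ 2
    by near: n; exact: H1.
  have := H1_sup_le (cD n) (wD n) (sD n) (sD' n) e4 h1 h2 x.
  by rewrite mulrCA divff// mulr1.
Unshelve. all: by end_near. Qed.

Lemma cvg_E_zeta (X_ : nat -> lagrangian R) (X : lagrangian R) (e : R) :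
  (forall n, in_F0 (X_ n)) -> in_F0 X -> cvg_E X_ X -> 0 < e ->
  \forall n \near \oo, forall x, `|la_zeta (X_ n) x - la_zeta X x| <= e.
Proof.
move=> FX_ FX XX e0; near=> n.
have [h1 _ _ _] : components_le (la_sub (X_ n) X) e by near: n; exact: cvg_E_near.
apply: continuous_norm_Lpoo_le h1 => x.
have [[[c _ _ _] _ _ _] _] := FX; have [[[c_ _ _ _] _ _ _] _] := FX_ n.
by apply: cvgB; [exact: c_|exact: c].
Unshelve. all: by end_near. Qed.

End convergence.

(** * Weak and uniform convergence through varying flows *)

Section eulerian_convergence.
Context (R : realType).

(** Take p and q with y p = a and y q = b. The integral of w_n over []y_n p, y_n q]] is that of W_n
    over []p, q]], which tends to that of W, equal to that of w over []a, b]]. Moving the end points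
    back to a and b costs little by the uniform energy bound. The densities are abstract because
    both u_x and rhobar are concerned. *)
Lemma flow_weak_cvg (y_ : nat -> R -> R) (y : R -> R)
    (w_ W_ : nat -> R -> R) (w W : R -> R) (C : R) :
  (forall n a b, a <= b -> y_ n a <= y_ n b) ->
  (forall a b, a <= b -> y a <= y b) -> (forall x, exists s, y s = x) ->
  (forall x, y_ n x @[n --> \oo] --> y x) ->
  (forall n, sq_integrable (w_ n)) -> sq_integrable w ->
  (forall n, \int[leb R]_x (w_ n x ^+ 2) <= C) -> L2_cvg W_ W ->
  (forall n a b, a <= b -> \int[leb R]_(x in `]a, b]) W_ n x =
    \int[leb R]_(x in `]y_ n a, y_ n b]) w_ n x) ->
  (forall a b, a <= b -> \int[leb R]_(x in `]a, b]) W x =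
    \int[leb R]_(x in `]y a, y b]) w x) ->
  weak_cvg_L2 w_ w.
Proof.
move=> my_ my ys yy sw_ sw wC WW K_ Kw.
apply: (weak_cvg_L2_of_itv (C := C)) => // a b ab.
have [p pa] := ys a; have [q qb] := ys b.
have pq : p <= q.
  by rewrite leNgt; apply/negP => /ltW /my; rewrite pa qb leNgt ab.
have C0 : 0 <= C by rewrite (le_trans _ (wC 0))// Rintegral_sqr_ge0.
have := L2_cvg_itv WW pq; rewrite (Kw _ _ pq) pa qb => WL.
apply/cvgrPdist_le => e e0.
(* This weight bounds the energy term by e / 4; the displaced end points and the convergence of W_n
   take e / 4 each. *)
pose d := e / (8 * (C + 1)).
have C1 : 0 < C + 1 by rewrite ltr_wpDl.
have d0 : 0 < d by rewrite divr_gt0// mulr_gt0.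
have dC : 2 * d * C <= e / 4.
  have -> : 2 * d * C = e / 4 * (C / (C + 1)) by rewrite /d; field; rewrite gt_eqF.
  by rewrite ler_piMr ?divr_ge0 ?(ltW e0)// ler_pdivrMr ?mul1r ?lerDl.
have e4 : 0 < e / 4 by rewrite divr_gt0.
have de : 0 < d * (e / 8) by rewrite mulr_gt0// divr_gt0.
move/cvgrPdist_le : WL => /(_ _ e4) WL.
have := yy p; rewrite pa => /cvgrPdist_le/(_ _ de) Yp.
have := yy q; rewrite qb => /cvgrPdist_le/(_ _ de) Yq.
near=> n.
have h1 : `|a - y_ n p| <= d * (e / 8) by near: n.
have h2 : `|b - y_ n q| <= d * (e / 8) by near: n.
have : `|\int[leb R]_(x in `]a, b]) w x - \int[leb R]_(x in `]p, q]) W_ n x| <= e / 4.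
  by near: n.
rewrite K_// => h3.
have h4 := Rintegral_itv_dist (sw_ n) d0 (my_ n _ _ pq) (ltW ab).
have h5 : 2 * d * \int[leb R]_x (w_ n x ^+ 2) <= e / 4.
  by rewrite (le_trans _ dC)// ler_wpM2l// mulr_ge0// ltW.
have h6 : d^-1 * (`|y_ n p - a| + `|y_ n q - b|) <= e / 4.
  by rewrite mulrC ler_pdivrMr// (distrC _ a) (distrC _ b); lra.
move: h3 h4; rewrite !ler_norml => /andP[? ?] /andP[? ?].
by apply/andP; split; lra.
Unshelve. all: by end_near. Qed.

(** Every point is x = y_n s, where u_n x - u x = (U_n s - U s) + (u (y s) - u (y_n s)). The last
    difference is bounded through the energy of u_x, uniformly in s. *)
Lemma flow_unif_cvg (y_ u_ U_ : nat -> R -> R) (y u U : R -> R) (e : R) :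
  (forall n x, exists s, y_ n s = x) ->
  (forall n x, u_ n (y_ n x) = U_ n x) -> (forall x, u (y x) = U x) ->
  (forall d : R, 0 < d -> \forall n \near \oo,
    forall x, `|y_ n x - y x| <= d) ->
  (forall d : R, 0 < d -> \forall n \near \oo,
    forall x, `|U_ n x - U x| <= d) ->
  continuous u -> weakly_differentiable u -> sq_integrable (wderiv u) -> 0 < e ->
  \forall n \near \oo, forall x, `|u_ n x - u x| <= e.
Proof.
move=> ys_ uU_ uU yy UU cu wu su e0.
pose C := \int[leb R]_x (wderiv u x ^+ 2).
have C0 : 0 <= C by exact: Rintegral_sqr_ge0.
pose d := e / (4 * (C + 1)).
have C1 : 0 < C + 1 by rewrite ltr_wpDl.
have d0 : 0 < d by rewrite divr_gt0// mulr_gt0.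
have dC : d * C <= e / 4.
  have -> : d * C = e / 4 * (C / (C + 1)) by rewrite /d; field; rewrite gt_eqF.
  by rewrite ler_piMr ?divr_ge0 ?(ltW e0)// ler_pdivrMr ?mul1r ?lerDl.
have e4 : 0 < e / 4 by rewrite divr_gt0.
have ud a b : `|u a - u b| <= d * C + d^-1 * `|a - b|.
  wlog ba : a b / b <= a.
    move=> H; have [|/ltW] := leP b a; first exact: H.
    by move=> /H; rewrite distrC (distrC b).
  rewrite wderiv_itv// (ger0_norm (_ : 0 <= a - b)) ?subr_ge0//.
  exact: Rintegral_itv_le_AMGM.
near=> n => x; have [s <-] := ys_ n x; rewrite uU_.
have h1 : forall x, `|U_ n x - U x| <= e / 4 by near: n; exact: UU.
have h2 : forall x, `|y_ n x - y x| <= d * (e / 4).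
  by near: n; apply: yy; rewrite mulr_gt0.
have h3 := ud (y s) (y_ n s).
have h4 : d^-1 * `|y s - y_ n s| <= e / 4.
  by rewrite mulrC ler_pdivrMr// mulrC distrC h2.
have := h1 s; move: h3; rewrite uU !ler_norml => /andP[? ?] /andP[? ?].
by apply/andP; split; lra.
Unshelve. all: by end_near. Qed.

(** If y x lies outside the window of radius m + K, then x lies outside that of radius m;
    substitution and 1 - h <= 1 compare the two tails. *)
Lemma flow_tail (h y u U : R -> R) (K m : R) :
  measurable_fun setT h -> (forall x, 0 <= h x <= 1) ->
  (forall a b, a <= b -> y b - y a = \int[leb R]_(x in `]a, b]) (1 - h x)) ->
  (forall x, `|y x - x| <= K) -> (forall x, u (y x) = U x) ->
  sq_integrable u -> sq_integrable U ->
  \int[leb R]_x (u x ^+ 2 * \1_(~` `]- (m + K), m + K]%classic) x) <=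
  \int[leb R]_x (U x ^+ 2 * \1_(~` `]- m, m]%classic) x).
Proof.
move=> mh h01 yE yK uU su sU.
have iu := integrable_sqr_indic su (measurableC (measurable_itv `](- (m + K)), (m + K)])).
have iU := integrable_sqr_indic sU (measurableC (measurable_itv `](- m), m])).
have [i <-] := flow_substitution mh h01 yE yK iu.
apply: (le_Rintegral _ i iU) => // x _; rewrite uU !indicE.
have /andP[h0 h1] := h01 x.
have [yx|yx] := boolP (y x \in ~` `](- (m + K)), (m + K)]%classic); last first.
  by rewrite mulr0 mul0r mulr_ge0 ?sqr_ge0.
rewrite mulr1 (_ : (x \in _) = true) ?mulr1.
  by rewrite ler_piMr ?sqr_ge0//; lra.
rewrite mem_set//= in_itv/= => /andP[mx xm].
move/set_mem: yx; apply; rewrite /= in_itv/=.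
have := yK x; rewrite ler_norml => /andP[? ?].
by apply/andP; split; lra.
Qed.

End eulerian_convergence.

(** * Strong convergence in L^2 through varying flows *)

Section strong_convergence.
Context (R : realType).

(** On a bounded window uniform convergence suffices. Outside, (u_n - u)^2 <= 2 u_n^2 + 2 u^2, and
    the tail of u_n is controlled by that of U_n, hence by that of U and the distance from U_n to
    U. *)
Lemma flow_L2_cvg (h_ y_ u_ U_ : nat -> R -> R) (u U : R -> R) (K e : R) :
  (forall n, measurable_fun setT (h_ n)) ->
  (forall n x, 0 <= h_ n x <= 1) ->
  (forall n a b, a <= b ->
    y_ n b - y_ n a = \int[leb R]_(x in `]a, b]) (1 - h_ n x)) ->
  0 <= K -> (\forall n \near \oo, forall x, `|y_ n x - x| <= K) ->
  (forall n x, u_ n (y_ n x) = U_ n x) ->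
  (forall n, sq_integrable (u_ n)) -> sq_integrable u -> L2_cvg U_ U ->
  (forall d : R, 0 < d -> \forall n \near \oo,
    forall x, `|u_ n x - u x| <= d) -> 0 < e ->
  \forall n \near \oo, \int[leb R]_x ((u_ n x - u x) ^+ 2) <= e.
Proof.
move=> mh_ h01_ yE_ K0 yK_ uU_ su_ su UU uu e0; have [sU_ [sU _]] := UU.
have tail (f : R -> R) : sq_integrable f -> \forall n \near \oo,
    \int[leb R]_x (f x ^+ 2 * \1_(~` `]- n%:R, n%:R]%classic) x) <= e / 64.
  move=> sf; have e64 : 0 < e / 64 by rewrite divr_gt0.
  have /cvgrPdist_le/(_ _ e64) := L2_tail_cvg sf; apply: filterS => n.
  by rewrite sub0r normrN; apply: le_trans; exact: ler_norm.
have [m [tU tu]] : exists m : nat,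
    \int[leb R]_x (U x ^+ 2 * \1_(~` `]- m%:R, m%:R]%classic) x) <= e / 64 /\
    \int[leb R]_x (u x ^+ 2 * \1_(~` `]- m%:R, m%:R]%classic) x) <= e / 64.
  have [N _ HN] : \forall n \near \oo,
      \int[leb R]_x (U x ^+ 2 * \1_(~` `]- n%:R, n%:R]%classic) x) <= e / 64 /\
      \int[leb R]_x (u x ^+ 2 * \1_(~` `]- n%:R, n%:R]%classic) x) <= e / 64.
    by apply: filterS2 (tail _ sU) (tail _ su) => n.
  by exists N; exact: HN (leqnn N).
pose M : R := m%:R + K; have M0 : 0 <= M by rewrite addr_ge0.
have M1 : 0 < M + 1 by rewrite ltr_wpDl.
(* Since d <= 1, d^2 <= d, so the window of length 2 M contributes at most e / 4. *)
pose d := Num.min 1 (e / (8 * (M + 1))).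
have d0 : 0 < d by rewrite lt_min ltr01 divr_gt0// mulr_gt0.
have dM : d ^+ 2 * (2 * M) <= e / 4.
  apply: (@le_trans _ _ (e / (8 * (M + 1)) * (2 * M))).
    rewrite ler_wpM2r ?mulr_ge0// expr2.
    rewrite (@le_trans _ _ d)//; last by rewrite ge_min lexx orbT.
    by rewrite ler_piMr ?(ltW d0)// ge_min lexx.
  have -> : e / (8 * (M + 1)) * (2 * M) = e / 4 * (M / (M + 1)).
    by field; rewrite gt_eqF.
  by rewrite ler_piMr ?divr_ge0 ?(ltW e0)// ler_pdivrMr ?mul1r ?lerDl.
have tuM : \int[leb R]_x (u x ^+ 2 * \1_(~` `]- M, M]%classic) x) <= e / 64.
  (* For the identity flow, with h = 0, [flow_tail] says that the tail shrinks as the window grows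
     from m to M. *)
  apply: le_trans tu; apply: (@flow_tail _ (fun=> 0) id) => //.
  - by move=> x; rewrite lexx ler01.
  - by move=> a b ab; rewrite subr0 Rintegral_cst_itv// mul1r.
  - by move=> x; rewrite subrr normr0.
have e64 : 0 < e / 64 by rewrite divr_gt0.
near=> n.
have yKn : forall x, `|y_ n x - x| <= K by near: n.
have und : forall x, `|u_ n x - u x| <= d by near: n; exact: uu.
have UUn : \int[leb R]_x ((U_ n x - U x) ^+ 2) <= e / 64.
  by near: n; exact: L2_cvg_near.
(* U_n^2 <= 2 (U_n - U)^2 + 2 U^2, hence 2 e / 64 + 2 e / 64. *)
have tUn : \int[leb R]_x (U_ n x ^+ 2 * \1_(~` `]- m%:R, m%:R]%classic) x) <= e / 16.
  have sD := sq_integrableB (sU_ n) sU; have [_ iD] := sD.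
  have iU := integrable_sqr_indic sU (measurableC (measurable_itv `](- m%:R), m%:R])).
  have iUn := integrable_sqr_indic (sU_ n) (measurableC (measurable_itv `](- m%:R), m%:R])).
  have iD2 := integrable_scaler 2 measurableT iD.
  have iU2 := integrable_scaler 2 measurableT iU.
  have iDU := integrable_addr measurableT iD2 iU2.
  have := le_Rintegral measurableT iUn iDU.
  rewrite RintegralD// !RintegralZl// => H.
  apply: (le_trans (H _)); last by lra.
  move=> x _; rewrite indicE; case: (_ \in _).
    rewrite !mulr1; move: (U_ n x) (U x) => a b.
    by have := sqr_ge0 (a - 2 * b); nra.
  by rewrite !mulr0 addr0 mulr_ge0// sqr_ge0.
have tun := flow_tail m%:R (mh_ n) (h01_ n) (yE_ n) yKn (uU_ n) (su_ n) (sU_ n).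
have mJ : measurable (`]- M, M]%classic : set (borelR R)) by exact: measurable_itv.
have iu := integrable_sqr_indic su (measurableC (measurable_itv `](- M), M])).
have iun := integrable_sqr_indic (su_ n) (measurableC (measurable_itv `](- M), M])).
have iJ : (leb R).-integrable setT (EFin \o (fun x => \1_(`]- M, M]%classic) x : R)).
  have [_] := sq_integrable_indic mJ (finite_measure_segment _ _).
  apply: eq_integrable => // x _ /=.
  by rewrite indicE; case: (_ \in _); rewrite ?expr1n ?expr0n.
have J2M : \int[leb R]_x (\1_(`]- M, M]%classic) x : R) = 2 * M.
  have : \int[leb R]_(x in `]- M, M]) (1 : R) = 2 * M.
    by rewrite Rintegral_cst_itv ?ge0_cp// mul1r opprK mulrDl mul1r.
  move=> <-; rewrite [RHS]Rintegral_mkcond; apply: eq_Rintegral => x _.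
  by rewrite patchE indicE; case: ifP.
have [_ iD] := sq_integrableB (su_ n) su.
have i1 := integrable_scaler (d ^+ 2) measurableT iJ.
have i2 := integrable_scaler 2 measurableT iun.
have i3 := integrable_scaler 2 measurableT iu.
have i12 := integrable_addr measurableT i1 i2.
have i123 := integrable_addr measurableT i12 i3.
have := le_Rintegral measurableT iD i123.
rewrite !RintegralD// !RintegralZl// J2M => H.
(* In total: e / 4 from the window, 2 e / 16 from the tail of u_n and 2 e / 64 from that of u. *)
apply: (le_trans (H _)); last first.
  have t1 := ler_wpM2l (ler0n R 2) (le_trans tun tUn).
  have t2 := ler_wpM2l (ler0n R 2) tuM.
  by apply: (le_trans (lerD (lerD dM t1) t2)); lra.
move=> x _; rewrite !indicE in_setC; case: (_ \in _) => /=.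
  rewrite !mulr0 !addr0 mulr1 -[leLHS](real_normK (num_real _)).
  by rewrite lerXn2r ?nnegrE// ltW.
rewrite !mulr0 add0r !mulr1; move: (u_ n x) (u x) => a b.
by have := sqr_ge0 (a + b); nra.
Unshelve. all: by end_near. Qed.

Lemma cvge0_near (a_ : nat -> \bar R) : (forall n, (0 <= a_ n)%E) ->
  (forall e : R, 0 < e -> \forall n \near \oo, (a_ n <= e%:E)%E) ->
  a_ @ \oo --> 0%E.
Proof.
move=> a0 ae; apply/fine_cvgP; split.
  have := ae 1 ltr01; apply: filterS => n an.
  by rewrite ge0_fin_numE// (le_lt_trans an)// ltry.
apply/cvgrPdist_le => e e0; have := ae e e0; apply: filterS => n an.
rewrite sub0r normrN ger0_norm ?fine_ge0// -lee_fin fineK//.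
by rewrite ge0_fin_numE// (le_lt_trans an)// ltry.
Qed.

Lemma norm_Lp2_ge (f : R -> R) (e : R) : sq_integrable f -> 0 <= e ->
  \int[leb R]_x (f x ^+ 2) <= e ^+ 2 -> (norm_Lp 2%:E f <= e%:E)%E.
Proof.
move=> [mf fi] e0 fe; rewrite norm_Lp2E.
have -> : e%:E = ((e ^+ 2)%:E `^ 2^-1)%E.
  by rewrite poweR_EFin -powR_mulrn// -powRrM divff// powRr1.
apply: gt0_ler_poweR.
- by rewrite invr_ge0.
- by rewrite in_itv/= leey andbT integral_ge0// => x _; rewrite lee_fin sqr_ge0.
- by rewrite in_itv/= leey lee_fin sqr_ge0.
- by move: fe; rewrite -lee_fin /Rintegral fineK// integrable_fin_num.
Qed.

Lemma eu_mu_setT_le (Y : eulerian R) (c : R) :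
  (forall x, dist_fun (eu_mu Y) x <= c) -> fine (eu_mu Y setT) <= c.
Proof.
move=> Fc; apply: (@closed_cvg _ _ \oo _ (fun n => dist_fun (eu_mu Y) n%:R)
  (fun z => z <= c)) => //.
- by apply: nearW => n; exact: Fc.
- exact: dist_fun_cvg_setT.
Qed.

End strong_convergence.

Theorem theorem4p3 (R : realType)
  (X_ : nat -> lagrangian R) (X : lagrangian R)
  (hX_ : forall n, in_F0 (X_ n)) (hX : in_F0 X)
  (hcvg : cvg_E X_ X)
  (Y_ : nat -> eulerian R) (Y : eulerian R)
  (hY_ : forall n, in_D (Y_ n)) (hY : in_D Y)
  (hM_ : forall n, is_M (X_ n) (Y_ n)) (hM : is_M X Y) :
  cvg_D Y_ Y.
Proof.
have [h [K fl]] := in_F0_is_flow hX.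
have /choice[hK fl_] : forall n, exists hK : (R -> R) * R,
    is_flow (X_ n) hK.1 hK.2.
  by move=> n; have [h' [K' H]] := in_F0_is_flow (hX_ n); exists (h', K').
have [[mh h01 yE yK _] _] := fl.
have mh_ n : measurable_fun setT (hK n).1 by have [[]] := fl_ n.
have h01_ n : forall x, 0 <= (hK n).1 x <= 1 by have [[]] := fl_ n.
have yE_ n : forall a b, a <= b -> la_y (X_ n) b - la_y (X_ n) a =
    \int[leb R]_(x in `]a, b]) (1 - (hK n).1 x) by have [[]] := fl_ n.
have yK_ n : forall x, `|la_y (X_ n) x - x| <= (hK n).2 by have [[]] := fl_ n.
have ys x : exists s, la_y X s = x.
  by have [s [ys _]] := flow_fibre mh h01 yE yK x; exists s.
have ys_ n x : exists s, la_y (X_ n) s = x.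
  by have [s [ys' _]] := flow_fibre (mh_ n) (h01_ n) (yE_ n) (yK_ n) x; exists s.
have [UL2 UxL2 rL2 Usup] := cvg_E_L2 hX_ hX hcvg.
have zeta e : 0 < e -> \forall n \near \oo,
    forall x, `|la_zeta (X_ n) x - la_zeta X x| <= e.
  exact: cvg_E_zeta.
have yy e : 0 < e -> \forall n \near \oo, forall x, `|la_y (X_ n) x - la_y X x| <= e.
  move=> /zeta; apply: filterS => n H x; have := H x.
  by rewrite /la_y opprD addrACA subrr addr0.
have yyx x : la_y (X_ n) x @[n --> \oo] --> la_y X x.
  apply/cvgrPdist_le => e /yy; apply: filterS => n H.
  by rewrite distrC.
have [[cu /in_Lp2P su wu /in_Lp2P su'] /in_Lp2P sR _] := hY.
have cu_ n : continuous (eu_u (Y_ n)) by have [[]] := hY_ n.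
have su_ n : sq_integrable (eu_u (Y_ n)) by have [[_ /in_Lp2P]] := hY_ n.
have su'_ n : sq_integrable (wderiv (eu_u (Y_ n))).
  by have [[_ _ _ /in_Lp2P]] := hY_ n.
have sR_ n : sq_integrable (eu_rhobar (Y_ n)) by have [_ /in_Lp2P] := hY_ n.
have uU x : eu_u Y (la_y X x) = la_U X x by have [] := hM.
have uU_ n x : eu_u (Y_ n) (la_y (X_ n) x) = la_U (X_ n) x by have [] := hM_ n.
have usup e : 0 < e -> \forall n \near \oo,
    forall x, `|eu_u (Y_ n) x - eu_u Y x| <= e.
  exact: (flow_unif_cvg ys_ uU_ uU yy Usup cu wu su').
(* F_n(x) <= F(x + e) + e is at most the limit mass plus e; letting x grow gives one inequality, and
   exchanging X_n and X gives the other. *)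
have mucvg : fine (eu_mu (Y_ n) setT) @[n --> \oo] --> fine (eu_mu Y setT).
  apply/cvgrPdist_le => e e0; near=> n.
  have zn : forall x, `|la_zeta (X_ n) x - la_zeta X x| <= e.
    by near: n; exact: zeta.
  have zn' : forall x, `|la_zeta X x - la_zeta (X_ n) x| <= e.
    by move=> z; rewrite distrC.
  have A1 : fine (eu_mu (Y_ n) setT) <= fine (eu_mu Y setT) + e.
    apply: eu_mu_setT_le => x.
    rewrite (le_trans (dist_fun_le (hX_ n) hX (fl_ n) fl (hM_ n) hM zn x))//.
    by rewrite lerD2r; exact: dist_fun_le_setT.
  have A2 : fine (eu_mu Y setT) <= fine (eu_mu (Y_ n) setT) + e.
    apply: eu_mu_setT_le => x.
    rewrite (le_trans (dist_fun_le hX (hX_ n) fl (fl_ n) hM (hM_ n) zn' x))//.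
    by rewrite lerD2r; exact: dist_fun_le_setT.
  by move: A1 A2; rewrite ler_norml => A1 A2; apply/andP; split; lra.
(* A convergent sequence is bounded: the masses supply the energy bound, uniform in n, that weak
   convergence requires. *)
have [C muC] : exists C, forall n, fine (eu_mu (Y_ n) setT) <= C.
  have /cvg_seq_bounded[B [_ HB]] : cvgn (fun n => fine (eu_mu (Y_ n) setT)).
    by apply/cvg_ex; eexists; exact: mucvg.
  exists (B + 1) => n; have B1 : B < B + 1 by rewrite ltrDl.
  by rewrite (le_trans (ler_norm _))//; exact: (HB _ B1 n).
have mono_ n a b : a <= b -> la_y (X_ n) a <= la_y (X_ n) b.
  exact: flow_mono (h01_ n) (yE_ n) _ _.
have mono a b : a <= b -> la_y X a <= la_y X b by exact: flow_mono h01 yE _ _.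
split; [split|split; [|split; [|split; [|split; [|split; [|split]]]]]].
- apply: cvge0_near => [n|e e0]; first exact: Lnorm_ge0.
  (* Eventually y_n is within 1 of y, hence within |K| + 1 of the identity: one displacement bound
     for all large n. *)
  have K1 : 0 <= `|K| + 1 by rewrite addr_ge0.
  have yK1 : \forall n \near \oo, forall x, `|la_y (X_ n) x - x| <= `|K| + 1.
    have := yy 1 ltr01; apply: filterS => n H x.
    have := ler_normD (la_y (X_ n) x - la_y X x) (la_y X x - x).
    rewrite addrA subrK => /le_trans; apply; rewrite addrC lerD//.
    by rewrite (le_trans (yK x))// ler_norm.
  have e2 : 0 < e ^+ 2 by rewrite exprn_gt0.
  have := flow_L2_cvg mh_ h01_ yE_ K1 yK1 uU_ su_ su UL2 usup e2.
  apply: filterS => n H; apply: norm_Lp2_ge => //; last exact: ltW.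
  exact: sq_integrableB.
- apply: cvge0_near => [n|e /usup]; first exact: Lnorm_ge0.
  by apply: filterS => n H; exact: norm_Lpoo_le.
- apply: (flow_weak_cvg (C := C) mono_ mono ys yyx su'_ su' _ UxL2).
  + by move=> n; have [H _] := in_D_energy_le (hX_ n) (hY_ n); exact: le_trans (muC n).
  + by move=> n a b; exact: (is_M_wderiv_itv (hX_ n) (fl_ n)).
  + by move=> a b; exact: (is_M_wderiv_itv hX fl).
- apply: (flow_weak_cvg (C := C) mono_ mono ys yyx sR_ sR _ rL2).
  + by move=> n; have [_ H] := in_D_energy_le (hX_ n) (hY_ n); exact: le_trans (muC n).
  + by move=> n a b; exact: (is_M_rhobar_itv (hX_ n) (fl_ n)).
  + by move=> a b; exact: (is_M_rhobar_itv hX fl).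
- have [_ _ _ ->] := hM.
  have -> : (fun n => eu_k (Y_ n)) = (fun n => la_k (X_ n)).
    by apply/funext => n; have [] := hM_ n.
  apply/cvgrPdist_le => e /(cvg_E_near hcvg); apply: filterS => n [_ _ _].
  by rewrite distrC.
- rewrite (energy_ratio_wderiv hX fl hY hM).
  have -> : (fun n => energy_ratio (wderiv (eu_u (Y_ n))) (Y_ n)) =
      (fun n => \int[leb R]_x (wderiv (la_U (X_ n)) x ^+ 2)).
    by apply/funext => n; exact: (energy_ratio_wderiv (hX_ n) (fl_ n)).
  exact: (L2_cvg_sqr UxL2).
- rewrite (energy_ratio_rhobar hX fl hY hM).
  have -> : (fun n => energy_ratio (eu_rhobar (Y_ n)) (Y_ n)) =
      (fun n => \int[leb R]_x (la_rbar (X_ n) x ^+ 2)).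
    by apply/funext => n; exact: (energy_ratio_rhobar (hX_ n) (fl_ n)).
  exact: (L2_cvg_sqr rL2).
- move=> x cF; apply/cvgrPdist_le => e e0.
  have e2 : 0 < e / 2 by rewrite divr_gt0.
  have /cvgrPdist_le/(_ _ e2)/nbhs_ballP[r /= r0 Hr] := cF.
  (* d < r keeps x - d and x + d where F is within e / 2 of F(x), and d <= e / 2 absorbs the
     additive error. *)
  pose d := Num.min (r / 2) (e / 2).
  have r2 : 0 < r / 2 by rewrite divr_gt0.
  have d0 : 0 < d by rewrite lt_min r2.
  have dr : d < r by rewrite gt_min; apply/orP; left; lra.
  have de : d <= e / 2 by rewrite ge_min lexx orbT.
  near=> n.
  have zn : forall x, `|la_zeta (X_ n) x - la_zeta X x| <= d.
    by near: n; exact: zeta.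
  have zn' : forall x, `|la_zeta X x - la_zeta (X_ n) x| <= d.
    by move=> z; rewrite distrC.
  have A1 := dist_fun_le (hX_ n) hX (fl_ n) fl (hM_ n) hM zn x.
  (* Applied at x - d, so that the lower bound concerns F_n at x itself. *)
  have A2 := dist_fun_le hX (hX_ n) fl (fl_ n) hM (hM_ n) zn' (x - d).
  rewrite subrK in A2.
  have B1 : `|dist_fun (eu_mu Y) x - dist_fun (eu_mu Y) (x + d)| <= e / 2.
    by apply: Hr; rewrite /ball/= opprD addrA subrr sub0r normrN gtr0_norm.
  have B2 : `|dist_fun (eu_mu Y) x - dist_fun (eu_mu Y) (x - d)| <= e / 2.
    by apply: Hr; rewrite /ball/= opprB addrCA subrr addr0 gtr0_norm.
  move: B1 B2; rewrite !ler_norml => /andP[? ?] /andP[? ?].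
  by apply/andP; split; lra.
- exact: mucvg.
Unshelve. all: by end_near. Qed.
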